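(* Let $\mathcal{C}$ be a $k$-linear Hom-finite Krull-Schmidt exact category. The following statements are equivalent. (1) $\mathcal{C}$ has Auslander-Reiten duality. (2) $\mathcal{C}$ has right stably determined deflations. (3) $\mathcal{C}$ has left stably determined inflations.
   Context: Setting. $k$ is a commutative artinian ring, $\check k$ is its minimal injective cogenerator and $D=\operatorname{Hom}_k(-,\check k)$. $\mathcal{C}$ is a skeletally small, $k$-linear, Hom-finite (each $\operatorname{Hom}_{\mathcal{C}}(X,Y)$ is a finitely generated $k$-module), Krull-Schmidt (each object is a finite direct sum of objects with local endomorphism rings) exact category in the sense of Quillen: an additive category with a chosen class of kernel-cokernel pairs $X\xrightarrow{i}E\xrightarrow{d}Y$, called conflations, satisfying the usual axioms; $i$ is called an inflation and $d$ a deflation. $\operatorname{Ext}^1_{\mathcal{C}}(Y,X)$ is the $k$-module of equivalence classes of conflations $X\to E\to Y$. The opposite category $\mathcal{C}^{\mathrm{op}}$ is an exact category with the opposite conflations. Stable categories. A morphism $f\colon X\to Y$ is projectively trivial if for every $Z$ the map $\operatorname{Ext}^1_{\mathcal{C}}(f,Z)\colon\operatorname{Ext}^1_{\mathcal{C}}(Y,Z)\to\operatorname{Ext}^1_{\mathcal{C}}(X,Z)$ is zero; $\mathcal{P}(X,Y)$ is the set of such morphisms. It is injectively trivial if for every $Z$ the map $\operatorname{Ext}^1_{\mathcal{C}}(Z,f)\colon\operatorname{Ext}^1_{\mathcal{C}}(Z,X)\to\operatorname{Ext}^1_{\mathcal{C}}(Z,Y)$ is zero; $\mathcal{I}(X,Y)$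 is the set of such morphisms. $\mathcal{P}$ and $\mathcal{I}$ are ideals; $\underline{\mathcal{C}}=\mathcal{C}/\mathcal{P}$ and $\overline{\mathcal{C}}=\mathcal{C}/\mathcal{I}$, with morphism modules $\underline{\operatorname{Hom}}_{\mathcal{C}}$ and $\overline{\operatorname{Hom}}_{\mathcal{C}}$. Auslander-Reiten duality. $\mathcal{C}$ has Auslander-Reiten duality if there exist mutually quasi-inverse equivalences $\tau\colon\underline{\mathcal{C}}\to\overline{\mathcal{C}}$ and $\tau^-\colon\overline{\mathcal{C}}\to\underline{\mathcal{C}}$ together with isomorphisms, natural in the objects $X$ and $Y$, \[\overline{\operatorname{Hom}}_{\mathcal{C}}(Y,\tau X)\simeq D\operatorname{Ext}^1_{\mathcal{C}}(X,Y)\simeq\underline{\operatorname{Hom}}_{\mathcal{C}}(\tau^-Y,X).\] Determined morphisms. A morphism $f\colon X\to Y$ is right $C$-determined if each $g\colon T\to Y$ factors through $f$ (i.e. $g=f\circ t$ for some $t\colon T\to X$), provided that for each $h\colon C\to T$ the morphism $g\circ h$ factors through $f$. Notation. $\Gamma_C=\operatorname{End}_{\mathcal{C}}(C)^{\mathrm{op}}$; $\operatorname{Hom}_{\mathcal{C}}(C,Y)$ is a left $\Gamma_C$-module via precomposition. $\operatorname{Im}\operatorname{Hom}_{\mathcal{C}}(C,\alpha)$ is the image of $\operatorname{Hom}_{\mathcal{C}}(C,X)\to\operatorname{Hom}_{\mathcal{C}}(C,Y)$, $s\mapsto\alpha\circ s$. Right stably determined deflations. $\mathcal{C}$ has right stably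 determined deflations if for each object $Y$: (i) each deflation ending at $Y$ is right $C$-determined for some object $C$; and (ii) for each object $C$ and each $\Gamma_C$-submodule $H$ of $\operatorname{Hom}_{\mathcal{C}}(C,Y)$ such that $\mathcal{P}(C,Y)\subseteq H$, there exists some deflation $\alpha\colon X\to Y$ which is right $C$-determined and such that $H=\operatorname{Im}\operatorname{Hom}_{\mathcal{C}}(C,\alpha)$. $\mathcal{C}$ has left stably determined inflations if $\mathcal{C}^{\mathrm{op}}$ has right stably determined deflations. *)

(* Defs.v *)
From HB Require Import structures.
From mathcomp Require Import all_boot all_algebra generic_quotient ring_quotient.
From mathcomp Require Import boolp.

Set Implicit Arguments.
Unset Strict Implicit.
Unset Printing Implicit Defensive.

Import GRing.Theory.
Local Open Scope ring_scope.
Local Open Scope quotient_scope.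

Definition ring_ideal (k : comPzRingType) (I : k -> Prop) : Prop :=
  [/\ I 0, forall x y, I x -> I y -> I (x + y) & forall a x, I x -> I (a * x)].

Definition artinian (k : comPzRingType) : Prop :=
  forall I : nat -> k -> Prop,
    (forall n, ring_ideal (I n)) ->
    (forall n x, I n.+1 x -> I n x) ->
    exists N, forall n x, (N <= n)%N -> (I n x <-> I N x).

Definition fin_gen (k : comPzRingType) (M : lmodType k) : Prop :=
  exists n (v : 'I_n -> M), forall x, exists a : 'I_n -> k,
    x = \sum_i a i *: v i.

Definition injective_module (k : comPzRingType) (E : lmodType k) : Prop :=
  forall (A B : lmodType k) (i : {linear A -> B}) (f : {linear A -> E}),
    injective i -> exists g : {linear B -> E}, forall x, g (i x) = f x.

Definition cogenerator (k : comPzRingType) (E : lmodType k) : Prop :=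
  forall (M : lmodType k) (x : M), x <> 0 -> exists f : {linear M -> E}, f x <> 0.

Definition injective_cogenerator (k : comPzRingType) (E : lmodType k) : Prop :=
  injective_module E /\ cogenerator E.

(* Minimality: E embeds into every injective cogenerator.  For a commutative  *)
(* artinian ring this determines E up to isomorphism: it is the injective     *)
(* envelope of k / rad k.                                                     *)
Definition minimal_injective_cogenerator
    (k : comPzRingType) (E : lmodType k) : Prop :=
  injective_cogenerator E /\
  forall E' : lmodType k, injective_cogenerator E' ->
    exists j : {linear E -> E'}, injective j.

Section Dual.
Variables (k : comPzRingType) (E M : lmodType k).

Definition moddual := {linear M -> E}.

Lemma linear_ext (f g : {linear M -> E}) : f =1 g -> f = g.
Proof.
move=> /funext; case: f => f [[a] [b]]; case: g => g [[c] [d]] /= fg.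
subst g; congr GRing.Linear.Pack; congr GRing.Linear.Class.
  congr Algebra.isNmodMorphism.phant_Build; exact: Prop_irrelevance.
congr GRing.isScalable.phant_Build; exact: Prop_irrelevance.
Qed.

HB.instance Definition _ := gen_eqMixin moddual.
HB.instance Definition _ := gen_choiceMixin moddual.

Definition dual0 : moddual := \0.
Definition dual_add (f g : moddual) : moddual := (f \+ g).
Definition dual_opp (f : moddual) : moddual := (\- f).
Definition dual_scale (a : k) (f : moddual) : moddual := (a \*: f).

Lemma dual_addA : associative dual_add.
Proof. by move=> f g h; apply/linear_ext => x /=; rewrite addrA. Qed.
Lemma dual_addC : commutative dual_add.
Proof. by move=> f g; apply/linear_ext => x /=; rewrite addrC. Qed.
Lemma dual_add0 : left_id dual0 dual_add.
Proof. by move=> f; apply/linear_ext => x /=; rewrite add0r. Qed.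
Lemma dual_addN : left_inverse dual0 dual_opp dual_add.
Proof. by move=> f; apply/linear_ext => x /=; rewrite addNr. Qed.
HB.instance Definition _ :=
  GRing.isZmodule.Build moddual dual_addA dual_addC dual_add0 dual_addN.

Lemma dual_scaleA a b f :
  dual_scale a (dual_scale b f) = dual_scale (a * b) f.
Proof. by apply/linear_ext => x /=; rewrite scalerA. Qed.
Lemma dual_scale1 : left_id 1 dual_scale.
Proof. by move=> f; apply/linear_ext => x /=; rewrite scale1r. Qed.
Lemma dual_scaleDr : right_distributive dual_scale +%R.
Proof. by move=> a f g; apply/linear_ext => x /=; rewrite scalerDr. Qed.
Lemma dual_scaleDl f : {morph dual_scale^~ f : a b / a + b}.
Proof. by move=> a b; apply/linear_ext => x /=; rewrite scalerDl. Qed.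
HB.instance Definition _ := GRing.Zmodule_isLmodule.Build k moddual
  dual_scaleA dual_scale1 dual_scaleDr dual_scaleDl.
End Dual.

Record submodule (k : comPzRingType) (V : lmodType k) := Submodule {
  sm_in :> V -> Prop;
  sm0 : sm_in 0;
  smD : forall x y, sm_in x -> sm_in y -> sm_in (x + y);
  smZ : forall a x, sm_in x -> sm_in (a *: x) }.

Section QuotLmod.
Variables (k : comPzRingType) (V : lmodType k) (W : submodule V).

Definition sm_pred : {pred V} := fun x => `[< W x >].

Lemma sm_predE x : (x \in sm_pred) = `[< W x >]. Proof. by []. Qed.

Lemma sm_pred_closed : zmod_closed sm_pred.
Proof.
split=> [|x y]; rewrite !sm_predE; first exact/asboolP/sm0.
move=> /asboolP Wx /asboolP Wy; apply/asboolP/smD => //.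
by rewrite -scaleN1r; apply: smZ.
Qed.
HB.instance Definition _ := GRing.isZmodClosed.Build V sm_pred sm_pred_closed.

Definition qmod := Quotient.quot sm_pred.

HB.instance Definition _ := GRing.Zmodule.on qmod.

Definition qpi (x : V) : qmod := \pi x.

Lemma qpiP x y : qpi x = qpi y <-> W (x - y).
Proof.
split=> [/eqP|h]; last apply/eqP.
  by rewrite -Quotient.idealrBE sm_predE => /asboolP.
by rewrite -Quotient.idealrBE sm_predE; apply/asboolP.
Qed.

Lemma qreprK (x : qmod) : qpi (repr x) = x. Proof. exact: reprK. Qed.

Lemma qpi_repr x : W (x - repr (qpi x)).
Proof. by apply/qpiP; rewrite qreprK. Qed.

Lemma qpiD x y : qpi (x + y) = qpi x + qpi y.
Proof. exact: raddfD. Qed.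

Definition qscale (a : k) (x : qmod) : qmod := qpi (a *: repr x).

Lemma qpiZ a x : qpi (a *: x) = qscale a (qpi x).
Proof. by apply/qpiP; rewrite -scalerBr; apply/smZ/qpiP; rewrite qreprK. Qed.

Lemma qscaleA a b x : qscale a (qscale b x) = qscale (a * b) x.
Proof. by rewrite -[x]qreprK -!qpiZ scalerA. Qed.
Lemma qscale1 : left_id 1 qscale.
Proof. by move=> x; rewrite -[x]qreprK -!qpiZ scale1r. Qed.
Lemma qscaleDr : right_distributive qscale +%R.
Proof.
by move=> a x y; rewrite -[x]qreprK -[y]qreprK -!qpiZ -!qpiD -qpiZ scalerDr.
Qed.
Lemma qscaleDl x : {morph qscale^~ x : a b / a + b}.
Proof. by move=> a b; rewrite -[x]qreprK -!qpiZ -!qpiD scalerDl. Qed.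
HB.instance Definition _ := GRing.Zmodule_isLmodule.Build k qmod
  qscaleA qscale1 qscaleDr qscaleDl.

Lemma qpi_linear : linear qpi.
Proof. by move=> a x y; rewrite qpiD qpiZ. Qed.
End QuotLmod.

(* obj is a type in the same sense as the carriers of the Hom-modules, so     *)
(* C is (skeletally) small by construction, and Ext^1 below is a type.        *)
Record kcat (k : comPzRingType) := KCat {
  obj :> Type;
  hom : obj -> obj -> lmodType k;
  idm : forall X, hom X X;
  ccomp : forall X Y Z, hom Y Z -> hom X Y -> hom X Z;
  compA : forall W X Y Z (h : hom Y Z) (g : hom X Y) (f : hom W X),
    ccomp h (ccomp g f) = ccomp (ccomp h g) f;
  comp1m : forall X Y (f : hom X Y), ccomp (idm Y) f = f;
  compm1 : forall X Y (f : hom X Y), ccomp f (idm X) = f;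
  comp_linl : forall X Y Z (f : hom X Y), linear (fun g : hom Y Z => ccomp g f);
  comp_linr : forall X Y Z (g : hom Y Z), linear (@ccomp X Y Z g) }.

Arguments hom {k k0} _ _ : rename.
Arguments idm {k k0} _ : rename.
Arguments ccomp {k k0 X Y Z} _ _ : rename.
Notation "g ∘ f" := (ccomp g f) (at level 40, left associativity).

Section CatTheory.
Variables (k : comPzRingType) (C : kcat k).
Implicit Types X Y Z : C.

Lemma compDl X Y Z (g g' : hom Y Z) (f : hom X Y) :
  (g + g') ∘ f = g ∘ f + g' ∘ f.
Proof. by have := comp_linl f 1 g g'; rewrite !scale1r. Qed.
Lemma compDr X Y Z (g : hom Y Z) (f f' : hom X Y) :
  g ∘ (f + f') = g ∘ f + g ∘ f'.
Proof. by have := comp_linr g 1 f f'; rewrite !scale1r. Qed.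
Lemma comp0m X Y Z (f : hom X Y) : (0 : hom Y Z) ∘ f = 0.
Proof. by apply: (addrI (0 ∘ f)); rewrite -compDl !addr0. Qed.
Lemma compm0 X Y Z (g : hom Y Z) : g ∘ (0 : hom X Y) = 0.
Proof. by apply: (addrI (g ∘ 0)); rewrite -compDr !addr0. Qed.
Lemma compZl X Y Z a (g : hom Y Z) (f : hom X Y) : (a *: g) ∘ f = a *: (g ∘ f).
Proof. by have := comp_linl f a g 0; rewrite comp0m !addr0. Qed.
Lemma compZr X Y Z a (g : hom Y Z) (f : hom X Y) : g ∘ (a *: f) = a *: (g ∘ f).
Proof. by have := comp_linr g a f 0; rewrite compm0 !addr0. Qed.
Lemma compNl X Y Z (g : hom Y Z) (f : hom X Y) : (- g) ∘ f = - (g ∘ f).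
Proof. by rewrite -scaleN1r compZl scaleN1r. Qed.
Lemma compNr X Y Z (g : hom Y Z) (f : hom X Y) : g ∘ (- f) = - (g ∘ f).
Proof. by rewrite -scaleN1r compZr scaleN1r. Qed.

Definition is_iso X Y (f : hom X Y) : Prop :=
  exists g : hom Y X, g ∘ f = idm X /\ f ∘ g = idm Y.

Lemma iso_square X Y X' Y' (d : hom X Y) (d' : hom X' Y') (b : hom X X')
    (c : hom Y Y') (b' : hom X' X) (c' : hom Y' Y) :
  b ∘ b' = idm X' -> c' ∘ c = idm Y -> c ∘ d = d' ∘ b -> d ∘ b' = c' ∘ d'.
Proof.
by move=> bb cc e; rewrite -[d]comp1m -cc -(compA c') e -!compA bb compm1.
Qed.

Definition is_kernel X E Y (i : hom X E) (d : hom E Y) : Prop :=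
  d ∘ i = 0 /\
  forall T (t : hom T E), d ∘ t = 0 -> exists! s : hom T X, i ∘ s = t.

Definition is_cokernel X E Y (i : hom X E) (d : hom E Y) : Prop :=
  d ∘ i = 0 /\
  forall T (t : hom E T), t ∘ i = 0 -> exists! s : hom Y T, s ∘ d = t.

Definition is_pushout X E X' E'
    (i : hom X E) (f : hom X X') (h : hom E E') (i' : hom X' E') : Prop :=
  h ∘ i = i' ∘ f /\
  forall T (a : hom E T) (b : hom X' T), a ∘ i = b ∘ f ->
    exists! c : hom E' T, c ∘ h = a /\ c ∘ i' = b.

Definition is_pullback Y E Y' E'
    (d : hom E Y) (g : hom Y' Y) (h : hom E' E) (d' : hom E' Y') : Prop :=
  d ∘ h = g ∘ d' /\
  forall T (a : hom T E) (b : hom T Y'), d ∘ a = g ∘ b ->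
    exists! c : hom T E', h ∘ c = a /\ d' ∘ c = b.

Record biproduct X Y := Biproduct {
  bp_obj : C;
  bp_inl : hom X bp_obj;
  bp_inr : hom Y bp_obj;
  bp_prl : hom bp_obj X;
  bp_prr : hom bp_obj Y;
  bp_ll : bp_prl ∘ bp_inl = idm X;
  bp_rr : bp_prr ∘ bp_inr = idm Y;
  bp_lr : bp_prl ∘ bp_inr = 0;
  bp_rl : bp_prr ∘ bp_inl = 0;
  bp_sum : bp_inl ∘ bp_prl + bp_inr ∘ bp_prr = idm bp_obj }.

Definition direct_sum_of X n (F : 'I_n -> C) : Prop :=
  exists (inj : forall i, hom (F i) X) (prj : forall i, hom X (F i)),
  [/\ forall i, prj i ∘ inj i = idm (F i),
      forall i j, i <> j -> prj i ∘ inj j = 0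
    & \sum_i inj i ∘ prj i = idm X].

Definition local_End X : Prop :=
  idm X <> 0 /\
  forall f g : hom X X, ~ is_iso f -> ~ is_iso g -> ~ is_iso (f + g).

Definition krull_schmidt : Prop :=
  forall X, exists n (F : 'I_n -> C),
    direct_sum_of X F /\ forall i, local_End (F i).

Definition hom_finite : Prop := forall X Y, fin_gen (hom X Y).

End CatTheory.

Section Opposite.
Variables (k : comPzRingType) (C : kcat k).

Definition op_kcat : kcat k := @KCat k C
  (fun X Y => hom Y X) (fun X => idm X) (fun X Y Z g f => f ∘ g)
  (fun W X Y Z h g f => esym (compA f g h))
  (fun X Y f => compm1 f) (fun X Y f => comp1m f)
  (fun X Y Z f => @comp_linr k C Z Y X f)
  (fun X Y Z g => @comp_linl k C Z Y X g).

Definition op_biproduct (X Y : C) (b : biproduct X Y) :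
    @biproduct k op_kcat X Y :=
  @Biproduct k op_kcat X Y (bp_obj b) (bp_prl b) (bp_prr b) (bp_inl b)
    (bp_inr b) (bp_ll b) (bp_rr b) (bp_rl b) (bp_lr b) (bp_sum b).
End Opposite.

Definition conflation_class (k : comPzRingType) (C : kcat k) : Type :=
  forall X E Y : C, hom X E -> hom E Y -> Prop.

Section ExactAxioms.
Variables (k : comPzRingType) (C : kcat k) (confl : conflation_class C).

Definition inflation_for (X E : C) (i : hom X E) : Prop :=
  exists Y (d : hom E Y), confl i d.
Definition deflation_for (E Y : C) (d : hom E Y) : Prop :=
  exists X (i : hom X E), confl i d.

Record exact_axioms : Prop := ExactAxioms {
  ex_zero : exists Z : C, idm Z = 0;
  ex_biproduct : forall X Y : C, inhabited (biproduct X Y);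
  ex_kernel : forall X E Y (i : hom X E) (d : hom E Y),
    confl i d -> is_kernel i d;
  ex_cokernel : forall X E Y (i : hom X E) (d : hom E Y),
    confl i d -> is_cokernel i d;
  ex_iso : forall X E Y X' E' Y' (i : hom X E) (d : hom E Y)
      (i' : hom X' E') (d' : hom E' Y')
      (a : hom X X') (b : hom E E') (c : hom Y Y'),
    is_iso a -> is_iso b -> is_iso c ->
    b ∘ i = i' ∘ a -> c ∘ d = d' ∘ b -> confl i d -> confl i' d';
  ex_infl1 : forall X : C, inflation_for (idm X);
  ex_defl1 : forall X : C, deflation_for (idm X);
  ex_infl_comp : forall X Y Z (i : hom X Y) (j : hom Y Z),
    inflation_for i -> inflation_for j -> inflation_for (j ∘ i);
  ex_defl_comp : forall X Y Z (p : hom X Y) (q : hom Y Z),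
    deflation_for p -> deflation_for q -> deflation_for (q ∘ p);
  ex_infl_pushout : forall X E X' (i : hom X E) (f : hom X X'),
    inflation_for i -> exists E' (h : hom E E') (i' : hom X' E'),
      is_pushout i f h i' /\ inflation_for i';
  ex_defl_pullback : forall Y E Y' (d : hom E Y) (g : hom Y' Y),
    deflation_for d -> exists E' (h : hom E' E) (d' : hom E' Y'),
      is_pullback d g h d' /\ deflation_for d' }.
End ExactAxioms.

Record exactCat (k : comPzRingType) := ExactCat {
  ex_cat :> kcat k;
  confl : conflation_class ex_cat;
  ex_axioms : exact_axioms confl }.

Arguments confl {k e X E Y} _ _ : rename.

Definition inflation (k : comPzRingType) (C : exactCat k) (X E : C)
  (i : hom X E) : Prop := inflation_for (@confl k C) i.
Definition deflation (k : comPzRingType) (C : exactCat k) (E Y : C)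
  (d : hom E Y) : Prop := deflation_for (@confl k C) d.

Section OppositeExact.
Variables (k : comPzRingType) (C : exactCat k).

Definition op_confl : conflation_class (op_kcat C) :=
  fun X E Y i d => @confl k C Y E X d i.

Lemma op_exact_axioms : exact_axioms op_confl.
Proof.
have ax := ex_axioms C; split.
- exact: ex_zero ax.
- by move=> X Y; case: (ex_biproduct ax X Y) => b; constructor; apply: op_biproduct.
- by move=> X E Y i d; apply: (ex_cokernel ax).
- by move=> X E Y i d; apply: (ex_kernel ax).
- move=> X E Y X' E' Y' i d i' d' a b c [a' [a1 a2]] [b' [b1 b2]] [c' [c1 c2]] /= ei ed.
  apply: (@ex_iso _ _ _ ax _ _ _ _ _ _ _ _ _ _ c' b' a').
  + by exists c; split.
  + by exists b; split.
  + by exists a; split.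
  + exact/esym/(@iso_square k C _ _ _ _ d' d c b c' b' c1 b2)/esym.
  + exact/esym/(@iso_square k C _ _ _ _ i' i b a b' a' b1 a2)/esym.
- exact: ex_defl1 ax.
- exact: ex_infl1 ax.
- by move=> X Y Z i j hi hj; apply: (ex_defl_comp ax).
- by move=> X Y Z i j hi hj; apply: (ex_infl_comp ax).
- by move=> X E X' i f; apply: (ex_defl_pullback ax).
- by move=> X E X' i f; apply: (ex_infl_pushout ax).
Qed.

Definition op_exactCat : exactCat k := ExactCat op_exact_axioms.
End OppositeExact.

Record conflation (k : comPzRingType) (C : exactCat k) (Y X : C) := Conflation {
  c_mid : C;
  c_inf : hom X c_mid;
  c_def : hom c_mid Y;
  c_conf : confl c_inf c_def }.

HB.instance Definition _ k C Y X := gen_eqMixin (@conflation k C Y X).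
HB.instance Definition _ k C Y X := gen_choiceMixin (@conflation k C Y X).

Section ConflationEquiv.
Variables (k : comPzRingType) (C : exactCat k) (Y X : C).

Definition conf_equiv (c c' : conflation Y X) : Prop :=
  exists h : hom (c_mid c) (c_mid c'),
    [/\ is_iso h, h ∘ c_inf c = c_inf c' & c_def c' ∘ h = c_def c].

Definition conf_equivb (c c' : conflation Y X) : bool := `[< conf_equiv c c' >].

Lemma conf_equivb_is_equiv : equiv_class_of conf_equivb.
Proof.
split.
- move=> c; apply/asboolP; exists (idm _).
  by rewrite comp1m compm1; split=> //; exists (idm _); rewrite comp1m.
- suff h c c' : conf_equivb c c' -> conf_equivb c' c.
    by move=> c c'; apply/idP/idP; exact: h.
  move=> /asboolP [h [[g [gh hg]] hi hd]]; apply/asboolP; exists g; split.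
  + by exists h.
  + by rewrite -hi compA gh comp1m.
  + by rewrite -hd -compA hg compm1.
- move=> c2 c1 c3 /asboolP [h [[h' [h1 h2]] hi hd]].
  move=> /asboolP [g [[g' [g1 g2]] gi gd]].
  apply/asboolP; exists (g ∘ h); split.
  + exists (h' ∘ g'); split.
      by rewrite -compA (compA g') g1 comp1m.
    by rewrite -compA (compA h) h2 comp1m.
  + by rewrite -compA hi.
  + by rewrite compA gd.
Qed.

Canonical conf_equiv_rel := EquivRelPack conf_equivb_is_equiv.
Canonical conf_encModRel := defaultEncModRel conf_equivb.

Definition Ext : Type := {eq_quot conf_equivb}.

HB.instance Definition _ := Choice.on Ext.

Definition cl (c : conflation Y X) : Ext := \pi_({eq_quot conf_equivb}) c.
Definition rep (x : Ext) : conflation Y X := repr (x : {eq_quot conf_equivb}).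

Lemma repK x : cl (rep x) = x. Proof. exact: reprK. Qed.

Lemma clP c c' : cl c = cl c' <-> conf_equiv c c'.
Proof.
split=> [/eqP|h]; last apply/eqP.
  by rewrite /cl piE /= => /asboolP.
by rewrite /cl piE /=; apply/asboolP.
Qed.
End ConflationEquiv.

Section Extensions.
Variables (k : comPzRingType) (C : exactCat k).
Implicit Types X Y Z : C.

Let ax : exact_axioms (@confl k C) := ex_axioms C.

Lemma confl0 X E Y (i : hom X E) (d : hom E Y) : confl i d -> d ∘ i = 0.
Proof. by case/(ex_kernel ax). Qed.

Lemma confl_mono X E Y (i : hom X E) (d : hom E Y) T (s t : hom T X) :
  confl i d -> i ∘ s = i ∘ t -> s = t.
Proof.
move=> c e; have [di /(_ T (i ∘ t))[|u [_ uP]]] := ex_kernel ax c.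
  by rewrite compA di comp0m.
by rewrite -(uP _ e) -(uP t).
Qed.

Lemma confl_epi X E Y (i : hom X E) (d : hom E Y) T (s t : hom Y T) :
  confl i d -> s ∘ d = t ∘ d -> s = t.
Proof.
move=> c e; have [di /(_ T (t ∘ d))[|u [_ uP]]] := ex_cokernel ax c.
  by rewrite -compA di compm0.
by rewrite -(uP _ e) -(uP t).
Qed.

Lemma confl_lift X E Y (i : hom X E) (d : hom E Y) T (t : hom T E) :
  confl i d -> d ∘ t = 0 -> exists s, i ∘ s = t.
Proof. by move=> c e; have [_ /(_ T t e)[s [? _]]] := ex_kernel ax c; exists s. Qed.

Lemma confl_desc X E Y (i : hom X E) (d : hom E Y) T (t : hom E T) :
  confl i d -> t ∘ i = 0 -> exists s, s ∘ d = t.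
Proof. by move=> c e; have [_ /(_ T t e)[s [? _]]] := ex_cokernel ax c; exists s. Qed.

Lemma is_iso_idm X : is_iso (idm X).
Proof. by exists (idm X); rewrite comp1m. Qed.

Lemma short_five X Y (c c' : conflation Y X) (h : hom (c_mid c) (c_mid c')) :
  h ∘ c_inf c = c_inf c' -> c_def c' ∘ h = c_def c -> is_iso h.
Proof.
case: c c' h => [E i d C0] [E' i' d' C1] /= h hi hd.
have [|P [p [p' [[pp pU] [X0 [k0 K0]]]]]] := @ex_defl_pullback _ _ _ ax _ _ _ d d'.
  by exists X, i.
have [|r rE] := @confl_lift _ _ _ _ _ _ (p' - h ∘ p) C1.
  by rewrite compDr compNr compA hd pp subrr.
pose q := p + i ∘ r.
have hq : h ∘ q = p' by rewrite compDr compA hi rE addrC subrK.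
have [|s sE] := @confl_lift _ _ _ _ _ _ (p ∘ k0) C0.
  by rewrite compA pp -compA (confl0 K0) compm0.
have rk : r ∘ k0 = - s.
  apply: (confl_mono C1); rewrite compA rE compDl (confl0 K0) add0r compNl compNr.
  by congr (- _); rewrite -compA -sE compA hi.
have [|h' h'E] := @confl_desc _ _ _ _ _ _ q K0.
  by rewrite compDl -sE -compA rk compNr subrr.
have [|u [[u1 u2] _]] := pU _ (idm E) h; first by rewrite compm1 hd.
exists h'; split; last first.
  by apply: (confl_epi K0); rewrite -compA h'E hq comp1m.
have ru : r ∘ u = 0.
  apply: (confl_mono C1); rewrite compA rE compDl compNl -compA u1 u2 compm1.
  by rewrite subrr compm0.
by rewrite -u2 compA h'E compDl u1 -compA ru compm0 addr0.
Qed.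

Lemma cl_eq X Y (c c' : conflation Y X) (h : hom (c_mid c) (c_mid c')) :
  h ∘ c_inf c = c_inf c' -> c_def c' ∘ h = c_def c -> cl c = cl c'.
Proof.
by move=> hi hd; apply/clP; exists h; split=> //; exact: short_five hi hd.
Qed.

Lemma confl_coker X E Y Y' (i : hom X E) (d : hom E Y) (d' : hom E Y') :
  confl i d -> is_cokernel i d' -> confl i d'.
Proof.
move=> c [d'i d'U].
have [di dU] := ex_cokernel ax c.
have [a [aE _]] := dU _ _ d'i.
have [b [bE _]] := d'U _ _ di.
have ab : a ∘ b = idm Y'.
  have [u [_ uP]] := d'U _ _ d'i.
  by rewrite -(uP (idm _)) ?comp1m // (uP (a ∘ b)) // -compA bE aE.
have ba : b ∘ a = idm Y.
  by apply: (confl_epi c); rewrite -compA aE bE comp1m.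
apply: (ex_iso ax (is_iso_idm X) (is_iso_idm E) (c := a) _ _ _ c).
- by exists b.
- by rewrite comp1m compm1.
- by rewrite compm1.
Qed.

Lemma confl_ker X X' E Y (i : hom X E) (i' : hom X' E) (d : hom E Y) :
  confl i d -> is_kernel i' d -> confl i' d.
Proof.
move=> c [d'i d'U].
have [di dU] := ex_kernel ax c.
have [a [aE _]] := dU _ _ d'i.
have [b [bE _]] := d'U _ _ di.
have ba : b ∘ a = idm X'.
  have [u [_ uP]] := d'U _ _ d'i.
  by rewrite -(uP (idm _)) ?compm1 // (uP (b ∘ a)) // compA bE aE.
have ab : a ∘ b = idm X.
  by apply: (confl_mono c); rewrite compA aE bE compm1.
apply: (ex_iso ax (a := b) _ (is_iso_idm E) (is_iso_idm Y) _ _ c).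
- by exists a.
- by rewrite comp1m bE.
- by rewrite comp1m compm1.
Qed.

Lemma push_ex X X' Y (f : hom X X') (c : conflation Y X) :
  exists (c' : conflation Y X') (h : hom (c_mid c) (c_mid c')),
    is_pushout (c_inf c) f h (c_inf c') /\ c_def c' ∘ h = c_def c.
Proof.
case: c => E i d c /=.
have [|E' [h [i' [[e U] [Y' [d0 c0]]]]]] := @ex_infl_pushout _ _ _ ax _ _ _ i f.
  by exists Y, d.
have [|d' [[d'h d'i] _]] := U _ d (0 : hom X' Y).
  by rewrite (confl0 c) comp0m.
have cd : is_cokernel i' d'.
  split=> // T t ti.
  have [|s sE] := @confl_desc _ _ _ _ _ _ (t ∘ h) c.
    by rewrite -compA e compA ti comp0m.
  exists s; split=> [|s' s'E]; last first.
    by apply: (confl_epi c); rewrite sE -s'E -compA d'h.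
  have [|u [_ uP]] := U _ (t ∘ h) (t ∘ i').
    by rewrite -!compA e.
  rewrite -(uP t) // (uP (s ∘ d')) //.
  by rewrite -!compA d'h d'i sE compm0 ti.
by exists (Conflation (confl_coker c0 cd)), h.
Qed.

Lemma pull_ex X Y Y' (g : hom Y' Y) (c : conflation Y X) :
  exists (c' : conflation Y' X) (h : hom (c_mid c') (c_mid c)),
    is_pullback (c_def c) g h (c_def c') /\ h ∘ c_inf c' = c_inf c.
Proof.
case: c => E i d c /=.
have [|E' [h [d' [[e U] [X' [i0 c0]]]]]] := @ex_defl_pullback _ _ _ ax _ _ _ d g.
  by exists X, i.
have [|i' [[hi' d'i'] _]] := U _ i (0 : hom X Y').
  by rewrite (confl0 c) compm0.
have cd : is_kernel i' d'.
  split=> // T t ti.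
  have [|s sE] := @confl_lift _ _ _ _ _ _ (h ∘ t) c.
    by rewrite compA e -compA ti compm0.
  exists s; split=> [|s' s'E]; last first.
    by apply: (confl_mono c); rewrite sE -s'E compA hi'.
  have [|u [_ uP]] := U _ (h ∘ t) (d' ∘ t).
    by rewrite !compA e.
  rewrite -(uP t) // (uP (i' ∘ s)) //.
  by rewrite !compA hi' d'i' sE comp0m ti.
by exists (Conflation (confl_ker c0 cd)), h.
Qed.

Definition conf_push X X' Y (f : hom X X') (c : conflation Y X) :
  conflation Y X' := projT1 (cid (push_ex f c)).
Definition conf_pull X Y Y' (g : hom Y' Y) (c : conflation Y X) :
  conflation Y' X := projT1 (cid (pull_ex g c)).

(* push f is Ext^1(Y, f) and pull g is Ext^1(g, X). *)
Definition push X X' Y (f : hom X X') (x : Ext Y X) : Ext Y X' :=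
  cl (conf_push f (rep x)).
Definition pull X Y Y' (g : hom Y' Y) (x : Ext Y X) : Ext Y' X :=
  cl (conf_pull g (rep x)).

Definition cmor X Y X' Y' (f : hom X X') (g : hom Y Y')
    (c : conflation Y X) (c' : conflation Y' X') : Prop :=
  exists h : hom (c_mid c) (c_mid c'),
    h ∘ c_inf c = c_inf c' ∘ f /\ c_def c' ∘ h = g ∘ c_def c.

Definition mor X Y X' Y' (f : hom X X') (g : hom Y Y')
    (x : Ext Y X) (x' : Ext Y' X') : Prop := cmor f g (rep x) (rep x').

Lemma cmor_comp X Y X' Y' X'' Y'' (f : hom X X') (g : hom Y Y')
    (f' : hom X' X'') (g' : hom Y' Y'') c c' c'' :
  cmor f g c c' -> cmor f' g' c' c'' -> cmor (f' ∘ f) (g' ∘ g) c c''.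
Proof.
move=> [h [h1 h2]] [h' [h1' h2']]; exists (h' ∘ h).
by split; [rewrite -compA h1 !compA h1' | rewrite compA h2' -!compA h2].
Qed.

Lemma cmor_cl X Y X' Y' (f : hom X X') (g : hom Y Y') c c' :
  cmor f g c c' -> mor f g (cl c) (cl c').
Proof.
move=> m.
have e X0 Y0 (c0 c1 : conflation Y0 X0) : cl c0 = cl c1 -> cmor (idm _) (idm _) c0 c1.
  by move=> /clP[h [_ h1 h2]]; exists h; rewrite compm1 comp1m.
rewrite /mor -[f]comp1m -[g]comp1m -[idm X' ∘ f]compm1 -[idm Y' ∘ g]compm1.
apply: (cmor_comp (e _ _ _ c _)); first by rewrite repK.
by apply: (cmor_comp m); apply: e; rewrite repK.
Qed.

Lemma mor_comp X Y X' Y' X'' Y'' (f : hom X X') (g : hom Y Y')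
    (f' : hom X' X'') (g' : hom Y' Y'') x x' x'' :
  mor f g x x' -> mor f' g' x' x'' -> mor (f' ∘ f) (g' ∘ g) x x''.
Proof. exact: cmor_comp. Qed.

Lemma mor_idm X Y (x : Ext Y X) : mor (idm X) (idm Y) x x.
Proof. by exists (idm _); rewrite !comp1m !compm1. Qed.

Lemma mor1_eq X Y (x x' : Ext Y X) : mor (idm X) (idm Y) x x' -> x = x'.
Proof.
case=> h []; rewrite compm1 comp1m => h1 h2.
by rewrite -[x]repK -[x']repK; apply: cl_eq h1 h2.
Qed.

Lemma mor_push X X' Y (f : hom X X') (x : Ext Y X) :
  mor f (idm Y) x (push f x).
Proof.
rewrite -{1}[x]repK; apply: cmor_cl; rewrite /conf_push.
by case: cid => c' /= [h [[e _] d]]; exists h; rewrite comp1m.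
Qed.

Lemma mor_pull X Y Y' (g : hom Y' Y) (x : Ext Y X) :
  mor (idm X) g (pull g x) x.
Proof.
rewrite -{2}[x]repK; apply: cmor_cl; rewrite /conf_pull.
by case: cid => c' /= [h [[e _] d]]; exists h; rewrite compm1.
Qed.

Lemma mor_push_fact X X' Y Y' (f : hom X X') (g : hom Y Y') x x' :
  mor f g x x' -> mor (idm X') g (push f x) x'.
Proof.
move=> [h [h1 h2]]; rewrite -[x']repK; apply: cmor_cl; rewrite /conf_push.
case: cid => c' /= [p [[e U] d]].
have [u [[u1 u2] _]] := U _ _ _ h1.
exists u; split; first by rewrite u2 compm1.
have [|v [_ vP]] := U _ (g ∘ c_def (rep x)) (0 : hom X' Y').
  by rewrite -compA (confl0 (c_conf _)) compm0 comp0m.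
rewrite -(vP (c_def (rep x') ∘ u)); last first.
  by split; rewrite -compA ?u1 // u2 (confl0 (c_conf _)).
by apply: vP; split; rewrite -compA ?d // (confl0 (c_conf _)) compm0.
Qed.

Lemma mor_pull_fact X X' Y Y' (f : hom X X') (g : hom Y Y') x x' :
  mor f g x x' -> mor f (idm Y) x (pull g x').
Proof.
move=> [h [h1 h2]]; rewrite -[x]repK; apply: cmor_cl; rewrite /conf_pull.
case: cid => c' /= [p [[e U] d]].
have [u [[u1 u2] _]] := U _ _ _ h2.
exists u; split; last by rewrite u2 comp1m.
have [|v [_ vP]] := U _ (c_inf (rep x') ∘ f) (0 : hom X Y).
  by rewrite compA (confl0 (c_conf _)) compm0 comp0m.
rewrite -(vP (u ∘ c_inf (rep x))); last first.
  by split; rewrite compA ?u1 // u2 (confl0 (c_conf _)).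
by apply: vP; split; rewrite compA ?d // (confl0 (c_conf _)) comp0m.
Qed.

Lemma mor_eq X X' Y Y' (f : hom X X') (g : hom Y Y') x x' :
  mor f g x x' -> push f x = pull g x'.
Proof. by move=> m; apply/mor1_eq/mor_pull_fact/mor_push_fact. Qed.

Lemma push1 X Y (x : Ext Y X) : push (idm X) x = x.
Proof. by apply/esym/mor1_eq/mor_push. Qed.
Lemma pull1 X Y (x : Ext Y X) : pull (idm Y) x = x.
Proof. by apply/mor1_eq/mor_pull. Qed.

Lemma push_push X X' X'' Y (f : hom X X') (f' : hom X' X'') (x : Ext Y X) :
  push f' (push f x) = push (f' ∘ f) x.
Proof.
rewrite -[LHS]pull1; apply/esym/mor_eq.
by have := mor_comp (mor_push f x) (mor_push f' _); rewrite comp1m.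
Qed.

Lemma pull_pull X Y Y' Y'' (g : hom Y' Y) (g' : hom Y'' Y') (x : Ext Y X) :
  pull g' (pull g x) = pull (g ∘ g') x.
Proof.
rewrite -[LHS]push1; apply/mor_eq.
by have := mor_comp (mor_pull g' (pull g x)) (mor_pull g x); rewrite comp1m.
Qed.

Lemma pull_push X X' Y Y' (f : hom X X') (g : hom Y' Y) (x : Ext Y X) :
  pull g (push f x) = push f (pull g x).
Proof.
apply/esym/mor_eq.
by have := mor_comp (mor_pull g x) (mor_push f x); rewrite compm1 comp1m.
Qed.

Definition bp X Y : biproduct X Y :=
  projT1 (cid (let: inhabits b := ex_biproduct ax X Y in
               ex_intro (fun _ => True) b I)).
Local Notation "X ⊕ Y" := (bp_obj (bp X Y)) (at level 50, left associativity).
Local Notation inl := (bp_inl (bp _ _)).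
Local Notation inr := (bp_inr (bp _ _)).
Local Notation prl := (bp_prl (bp _ _)).
Local Notation prr := (bp_prr (bp _ _)).

Definition copair X Y T (a : hom X T) (b : hom Y T) : hom (X ⊕ Y) T :=
  a ∘ prl + b ∘ prr.
Definition bpair X Y T (a : hom T X) (b : hom T Y) : hom T (X ⊕ Y) :=
  inl ∘ a + inr ∘ b.
Definition bmap X Y X' Y' (f : hom X X') (g : hom Y Y') : hom (X ⊕ Y) (X' ⊕ Y') :=
  copair (inl ∘ f) (inr ∘ g).
Definition diag X : hom X (X ⊕ X) := bpair (idm X) (idm X).
Definition codiag X : hom (X ⊕ X) X := copair (idm X) (idm X).

Lemma copair_inl X Y T (a : hom X T) (b : hom Y T) : copair a b ∘ inl = a.
Proof. by rewrite compDl -!compA bp_ll bp_rl compm0 compm1 addr0. Qed.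
Lemma copair_inr X Y T (a : hom X T) (b : hom Y T) : copair a b ∘ inr = b.
Proof. by rewrite compDl -!compA bp_lr bp_rr compm0 compm1 add0r. Qed.
Lemma prl_pair X Y T (a : hom T X) (b : hom T Y) : prl ∘ bpair a b = a.
Proof. by rewrite compDr !compA bp_ll bp_lr comp0m comp1m addr0. Qed.
Lemma prr_pair X Y T (a : hom T X) (b : hom T Y) : prr ∘ bpair a b = b.
Proof. by rewrite compDr !compA bp_rl bp_rr comp0m comp1m add0r. Qed.

Lemma bp_ext X Y T (s t : hom (X ⊕ Y) T) :
  s ∘ inl = t ∘ inl -> s ∘ inr = t ∘ inr -> s = t.
Proof.
move=> e1 e2; rewrite -[s]compm1 -[t]compm1 -bp_sum !compDr !compA.
by rewrite e1 e2.
Qed.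

Lemma comp_copair X Y T T' (a : hom X T) (b : hom Y T) (c : hom T T') :
  c ∘ copair a b = copair (c ∘ a) (c ∘ b).
Proof. by rewrite compDr !compA. Qed.
Lemma copair_pair X Y T S (a : hom X T) (b : hom Y T) (c : hom S X) (d : hom S Y) :
  copair a b ∘ bpair c d = a ∘ c + b ∘ d.
Proof. by rewrite compDr !compA copair_inl copair_inr. Qed.
Lemma copair_bmap X Y X' Y' T (a : hom X' T) (b : hom Y' T)
    (f : hom X X') (g : hom Y Y') :
  copair a b ∘ bmap f g = copair (a ∘ f) (b ∘ g).
Proof. by rewrite comp_copair !compA copair_inl copair_inr. Qed.
Lemma bmap_pair X Y X' Y' T (c : hom T X) (d : hom T Y)
    (f : hom X X') (g : hom Y Y') :
  bmap f g ∘ bpair c d = bpair (f ∘ c) (g ∘ d).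
Proof. by rewrite copair_pair -!compA. Qed.
Lemma pair_comp X Y T S (c : hom T X) (d : hom T Y) (h : hom S T) :
  bpair c d ∘ h = bpair (c ∘ h) (d ∘ h).
Proof. by rewrite compDl -!compA. Qed.
Lemma bmap_bmap X Y X' Y' X'' Y'' (f : hom X X') (g : hom Y Y')
    (f' : hom X' X'') (g' : hom Y' Y'') :
  bmap f' g' ∘ bmap f g = bmap (f' ∘ f) (g' ∘ g).
Proof. by rewrite copair_bmap -!compA. Qed.
Lemma addE X Y (f g : hom X Y) : f + g = codiag Y ∘ bmap f g ∘ diag X.
Proof. by rewrite copair_bmap copair_pair !comp1m !compm1. Qed.

Lemma infl_pushout X E X' E' (i : hom X E) (f : hom X X') (h : hom E E')
    (i' : hom X' E') :
  is_pushout i f h i' -> inflation i -> inflation i'.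
Proof.
move=> [e U] /(ex_infl_pushout ax (i := i) f) [E0 [h0 [i0 [[e0 U0] [Y [d0 c0]]]]]].
have [u [[u1 u2] _]] := U0 _ _ _ e.
have [v [[v1 v2] _]] := U _ _ _ e0.
have uv : u ∘ v = idm E'.
  have [w [_ wP]] := U _ _ _ e.
  rewrite -(wP (idm _)) ?comp1m // (wP (u ∘ v)) //.
  by rewrite -!compA v1 v2 u1 u2.
have vu : v ∘ u = idm E0.
  have [w [_ wP]] := U0 _ _ _ e0.
  rewrite -(wP (idm _)) ?comp1m // (wP (v ∘ u)) //.
  by rewrite -!compA u1 u2 v1 v2.
exists Y, (d0 ∘ v).
apply: (ex_iso ax (is_iso_idm X') _ (is_iso_idm Y) (b := u) _ _ c0).
- by exists v.
- by rewrite u2 compm1.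
- by rewrite comp1m -compA vu compm1.
Qed.

Lemma confl_infl_coker X E Y (i : hom X E) (d : hom E Y) :
  inflation i -> is_cokernel i d -> confl i d.
Proof. by case=> Y' [d' c]; apply: confl_coker c. Qed.

Lemma infl_bmapl X E Z (i : hom X E) : inflation i -> inflation (bmap i (idm Z)).
Proof.
apply: (@infl_pushout _ _ _ _ _ inl inl); split; first by rewrite copair_inl.
move=> T a b e; exists (copair a (b ∘ inr)); split=> [|c [<- <-]].
  rewrite copair_inl; split=> //.
  rewrite copair_bmap e compm1; apply: bp_ext.
    by rewrite copair_inl.
  by rewrite copair_inr.
apply: bp_ext; first by rewrite copair_inl.
by rewrite copair_inr -compA copair_inr compm1.
Qed.

Lemma infl_bmapr X E Z (i : hom X E) : inflation i -> inflation (bmap (idm Z) i).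
Proof.
apply: (@infl_pushout _ _ _ _ _ inr inr); split; first by rewrite copair_inr.
move=> T a b e; exists (copair (b ∘ inl) a); split=> [|c [<- <-]].
  rewrite copair_inr; split=> //.
  rewrite copair_bmap e compm1; apply: bp_ext.
    by rewrite copair_inl.
  by rewrite copair_inr.
apply: bp_ext; last by rewrite copair_inr.
by rewrite copair_inl -compA copair_inl compm1.
Qed.

Lemma confl_bmap X E Y X' E' Y' (i : hom X E) (d : hom E Y)
    (i' : hom X' E') (d' : hom E' Y') :
  confl i d -> confl i' d' -> confl (bmap i i') (bmap d d').
Proof.
move=> c c'; apply: confl_infl_coker.
  rewrite -[i]comp1m -[i']compm1 -bmap_bmap.
  apply: (ex_infl_comp ax); first by apply: infl_bmapl; exists Y, d.
  by apply: infl_bmapr; exists Y', d'.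
split=> [|T t].
  rewrite bmap_bmap (confl0 c) (confl0 c').
  by rewrite /bmap !compm0 /copair !comp0m addr0.
move=> e.
have [|s sE] := @confl_desc _ _ _ _ _ _ (t ∘ inl) c.
  by rewrite -compA -[inl ∘ i](copair_inl _ (inr ∘ i')) compA e comp0m.
have [|s' sE'] := @confl_desc _ _ _ _ _ _ (t ∘ inr) c'.
  by rewrite -compA -[inr ∘ i'](copair_inr (inl ∘ i)) compA e comp0m.
exists (copair s s'); split.
  by rewrite copair_bmap sE sE'; apply: bp_ext; rewrite ?copair_inl ?copair_inr.
move=> w wE; apply: bp_ext.
  apply: (confl_epi c); rewrite copair_inl sE -wE -!compA.
  by rewrite copair_inl.
apply: (confl_epi c'); rewrite copair_inr sE' -wE -!compA.
by rewrite copair_inr.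
Qed.

Lemma confl_split X Y : confl (bp_inl (bp X Y)) (bp_prr (bp X Y)).
Proof.
apply: confl_infl_coker.
  have [X0 [i0 c0]] := ex_defl1 ax Y.
  apply: (@infl_pushout _ _ _ _ i0 0 inr); last by exists Y, (idm Y).
  split=> [|T a b e].
    by have := confl0 c0; rewrite comp1m => ->; rewrite !compm0.
  exists (copair b a); split=> [|c [<- <-]]; first by rewrite copair_inl copair_inr.
  by apply: bp_ext; rewrite ?copair_inl ?copair_inr.
split=> [|T t e]; first exact: bp_rl.
exists (t ∘ inr); split=> [|s <-]; last by rewrite -compA bp_rr compm1.
apply: bp_ext; rewrite -!compA; first by rewrite bp_rl !compm0 e.
by rewrite bp_rr compm1.
Qed.

Definition conf_split Y X : conflation Y X := Conflation (confl_split X Y).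
Definition conf_sum X Y X' Y' (c : conflation Y X) (c' : conflation Y' X') :
    conflation (Y ⊕ Y') (X ⊕ X') :=
  Conflation (confl_bmap (c_conf c) (c_conf c')).

Definition ext_sum X Y X' Y' (x : Ext Y X) (x' : Ext Y' X') :
  Ext (Y ⊕ Y') (X ⊕ X') := cl (conf_sum (rep x) (rep x')).

(* Baer's k-module structure on Ext^1(Y, X); scalars act through End(X). *)
Definition ext0 Y X : Ext Y X := cl (conf_split Y X).
Definition ext_add Y X (x x' : Ext Y X) : Ext Y X :=
  push (codiag X) (pull (diag Y) (ext_sum x x')).
Definition ext_scale Y X (a : k) (x : Ext Y X) : Ext Y X :=
  push (a *: idm X) x.
Definition ext_opp Y X (x : Ext Y X) : Ext Y X := ext_scale (-1) x.

Lemma mor_sum X1 Y1 X1' Y1' X2 Y2 X2' Y2' (f1 : hom X1 X1') (g1 : hom Y1 Y1')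
    (f2 : hom X2 X2') (g2 : hom Y2 Y2') x1 x1' x2 x2' :
  mor f1 g1 x1 x1' -> mor f2 g2 x2 x2' ->
  mor (bmap f1 f2) (bmap g1 g2) (ext_sum x1 x2) (ext_sum x1' x2').
Proof.
move=> [h1 [a1 b1]] [h2 [a2 b2]]; apply: cmor_cl; exists (bmap h1 h2) => /=.
by rewrite !bmap_bmap a1 a2 b1 b2.
Qed.

Lemma push_sum X1 Y1 X1' X2 Y2 X2' (f1 : hom X1 X1') (f2 : hom X2 X2')
    (x1 : Ext Y1 X1) (x2 : Ext Y2 X2) :
  push (bmap f1 f2) (ext_sum x1 x2) = ext_sum (push f1 x1) (push f2 x2).
Proof.
have /mor_eq -> := mor_sum (mor_push f1 x1) (mor_push f2 x2).
rewrite -[RHS]pull1; congr pull; apply: bp_ext;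
  by rewrite ?copair_inl ?copair_inr compm1 comp1m.
Qed.

Lemma pull_sum X1 Y1 Y1' X2 Y2 Y2' (g1 : hom Y1' Y1) (g2 : hom Y2' Y2)
    (x1 : Ext Y1 X1) (x2 : Ext Y2 X2) :
  pull (bmap g1 g2) (ext_sum x1 x2) = ext_sum (pull g1 x1) (pull g2 x2).
Proof.
have /mor_eq <- := mor_sum (mor_pull g1 x1) (mor_pull g2 x2).
rewrite -[RHS]push1; congr push; apply: bp_ext;
  by rewrite ?copair_inl ?copair_inr compm1 comp1m.
Qed.

Lemma push_diag Y X (x : Ext Y X) : push (diag X) x = pull (diag Y) (ext_sum x x).
Proof.
apply: mor_eq; rewrite -{1}[x]repK; apply: cmor_cl; exists (diag _) => /=.
by rewrite !bmap_pair !pair_comp !comp1m !compm1.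
Qed.

Lemma pull_codiag Y X (x : Ext Y X) :
  pull (codiag Y) x = push (codiag X) (ext_sum x x).
Proof.
apply/esym/mor_eq; rewrite -{3}[x]repK; apply: cmor_cl; exists (codiag _) => /=.
by rewrite !copair_bmap !comp_copair !comp1m !compm1.
Qed.

Lemma push_addr Y X X' (f : hom X X') (x x' : Ext Y X) :
  push f (ext_add x x') = ext_add (push f x) (push f x').
Proof.
rewrite /ext_add -push_sum pull_push !push_push; congr push.
by rewrite copair_bmap comp_copair compm1 comp1m.
Qed.

Lemma pull_addr Y Y' X (g : hom Y' Y) (x x' : Ext Y X) :
  pull g (ext_add x x') = ext_add (pull g x) (pull g x').
Proof.
rewrite /ext_add -pull_sum pull_push !pull_pull; congr (push _ (pull _ _)).
by rewrite bmap_pair pair_comp compm1 comp1m.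
Qed.

Lemma push_addl Y X X' (f f' : hom X X') (x : Ext Y X) :
  push (f + f') x = ext_add (push f x) (push f' x).
Proof.
by rewrite addE -push_push push_diag /ext_add -push_sum pull_push push_push.
Qed.

Lemma pull_addl Y Y' X (g g' : hom Y' Y) (x : Ext Y X) :
  pull (g + g') x = ext_add (pull g x) (pull g' x).
Proof.
by rewrite addE -!pull_pull pull_codiag /ext_add -pull_sum !pull_push.
Qed.

Lemma push0 Y X X' (x : Ext Y X) : push (0 : hom X X') x = ext0 Y X'.
Proof.
rewrite -[RHS]pull1; apply: mor_eq; rewrite -[x]repK; apply: cmor_cl.
exists (inr ∘ c_def (rep x)) => /=.
by rewrite -compA (confl0 (c_conf _)) compA bp_rr !compm0.
Qed.

Lemma ext_add0 Y X : left_id (ext0 Y X) (@ext_add Y X).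
Proof. by move=> x; rewrite -(push0 X x) -{2}[x]push1 -push_addl add0r push1. Qed.

Lemma ext_addN Y X : left_inverse (ext0 Y X) (@ext_opp Y X) (@ext_add Y X).
Proof.
move=> x; rewrite /ext_opp /ext_scale -{2}[x]push1 -push_addl scaleN1r addNr.
exact: push0.
Qed.

Definition bswap X Y : hom (X ⊕ Y) (Y ⊕ X) := copair inr inl.

Lemma ext_addC Y X : commutative (@ext_add Y X).
Proof.
move=> x x'; rewrite /ext_add.
have {1}-> : codiag X = codiag X ∘ bswap X X.
  by rewrite comp_copair copair_inl copair_inr.
rewrite -push_push -pull_push.
have /mor_eq -> : mor (bswap X X) (bswap Y Y) (ext_sum x x') (ext_sum x' x).
  apply: cmor_cl; exists (bswap _ _) => /=.
  by rewrite !copair_bmap !comp_copair !copair_inl !copair_inr.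
rewrite pull_pull; congr (push _ (pull _ _)).
by rewrite copair_pair addrC !compm1 /diag /bpair !compm1.
Qed.

Definition bassoc X Y Z : hom (X ⊕ Y ⊕ Z) (X ⊕ (Y ⊕ Z)) :=
  copair (copair inl (inr ∘ inl)) (inr ∘ inr).

Lemma bassoc_bmap X Y Z X' Y' Z' (f : hom X X') (g : hom Y Y') (h : hom Z Z') :
  bassoc X' Y' Z' ∘ bmap (bmap f g) h = bmap f (bmap g h) ∘ bassoc X Y Z.
Proof.
rewrite !copair_bmap 2!comp_copair !compA copair_inl copair_inr.
by rewrite -!compA copair_inl copair_inr.
Qed.

Lemma ext_sum_cl Y X Y' X' (c : conflation Y X) (c' : conflation Y' X') :
  ext_sum (cl c) (cl c') = cl (conf_sum c c').
Proof.
have /clP[a [_ a1 a2]] := repK (cl c).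
have /clP[b [_ b1 b2]] := repK (cl c').
by rewrite /ext_sum; apply: (@cl_eq _ _ (conf_sum _ _) (conf_sum c c') (bmap a b));
  rewrite /= bmap_bmap ?a1 ?b1 ?a2 ?b2.
Qed.

Lemma ext_addA Y X : associative (@ext_add Y X).
Proof.
move=> x y z; rewrite {1 3}/ext_add.
have -> : ext_sum x (ext_add y z) = push (bmap (idm X) (codiag X))
    (pull (bmap (idm Y) (diag Y)) (ext_sum x (ext_sum y z))).
  by rewrite pull_sum push_sum pull1 push1.
have -> : ext_sum (ext_add x y) z = push (bmap (codiag X) (idm X))
    (pull (bmap (diag Y) (idm Y)) (ext_sum (ext_sum x y) z)).
  by rewrite pull_sum push_sum pull1 push1.
rewrite !pull_push !push_push !pull_pull.
have /mor_eq m : mor (bassoc X X X) (bassoc Y Y Y)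
    (ext_sum (ext_sum x y) z) (ext_sum x (ext_sum y z)).
  rewrite -[x]repK -[y]repK -[z]repK !ext_sum_cl; apply: cmor_cl.
  exists (bassoc _ _ _) => /=.
  by rewrite !bassoc_bmap.
have -> : bmap (idm Y) (diag Y) ∘ diag Y
    = bassoc Y Y Y ∘ (bmap (diag Y) (idm Y) ∘ diag Y).
  rewrite !bmap_pair !comp1m compm1 copair_pair copair_pair !compm1.
  by rewrite /bpair compDr !compm1 addrA.
rewrite -[pull (_ ∘ _) (ext_sum x _)]pull_pull -m pull_push push_push.
congr push; rewrite !copair_bmap !comp1m /bassoc 2!comp_copair.
by rewrite !compA copair_inl copair_inr copair_inl copair_inr.
Qed.

Lemma ext_scaleA Y X a b (x : Ext Y X) :
  ext_scale a (ext_scale b x) = ext_scale (a * b) x.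
Proof. by rewrite /ext_scale push_push compZl comp1m scalerA. Qed.
Lemma ext_scale1 Y X : left_id 1 (@ext_scale Y X).
Proof. by move=> x; rewrite /ext_scale scale1r push1. Qed.
Lemma ext_scaleDr Y X : right_distributive (@ext_scale Y X) (@ext_add Y X).
Proof. by move=> a x y; apply: push_addr. Qed.
Lemma ext_scaleDl Y X (x : Ext Y X) a b :
  ext_scale (a + b) x = ext_add (ext_scale a x) (ext_scale b x).
Proof. by rewrite /ext_scale scalerDl push_addl. Qed.

End Extensions.

HB.instance Definition _ (k : comPzRingType) (C : exactCat k) (Y X : C) :=
  GRing.isZmodule.Build (Ext Y X)
    (@ext_addA k C Y X) (@ext_addC k C Y X) (@ext_add0 k C Y X) (@ext_addN k C Y X).
HB.instance Definition _ (k : comPzRingType) (C : exactCat k) (Y X : C) :=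
  GRing.Zmodule_isLmodule.Build k (Ext Y X)
    (@ext_scaleA k C Y X) (@ext_scale1 k C Y X) (@ext_scaleDr k C Y X)
    (fun x a b => @ext_scaleDl k C Y X x a b).

Record ideal (k : comPzRingType) (C : kcat k) := Ideal {
  ideal_in :> forall X Y : C, hom X Y -> Prop;
  ideal0 : forall X Y, ideal_in (0 : hom X Y);
  idealD : forall X Y (f g : hom X Y), ideal_in f -> ideal_in g -> ideal_in (f + g);
  idealMl : forall X Y Z (f : hom X Y) (g : hom Y Z), ideal_in f -> ideal_in (g ∘ f);
  idealMr : forall X Y Z (f : hom X Y) (g : hom Y Z), ideal_in g -> ideal_in (g ∘ f) }.

Section QuotientCategory.
Variables (k : comPzRingType) (C : kcat k) (J : ideal C).

Lemma idealZ (X Y : C) a (f : hom X Y) : J X Y f -> J X Y (a *: f).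
Proof. by move=> Jf; rewrite -[f]comp1m -compZl; apply: idealMl. Qed.

Definition ideal_submodule (X Y : C) : submodule (hom X Y) :=
  @Submodule k (hom X Y) (J X Y) (ideal0 J X Y) (@idealD _ _ J X Y) (@idealZ X Y).

Definition qhom (X Y : C) : lmodType k := qmod (ideal_submodule X Y).

Definition qcls (X Y : C) (f : hom X Y) : qhom X Y := qpi (ideal_submodule X Y) f.

Definition qcomp (X Y Z : C) (g : qhom Y Z) (f : qhom X Y) : qhom X Z :=
  qcls (repr g ∘ repr f).

Lemma qclsK (X Y : C) (f : qhom X Y) : qcls (repr f) = f.
Proof. exact: qreprK. Qed.

Lemma qclsM (X Y Z : C) (g : hom Y Z) (f : hom X Y) :
  qcls (g ∘ f) = qcomp (qcls g) (qcls f).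
Proof.
have Jg : J Y Z (g - repr (qcls g)) := qpi_repr (ideal_submodule Y Z) g.
have Jf : J X Y (f - repr (qcls f)) := qpi_repr (ideal_submodule X Y) f.
apply/qpiP => /=.
set g' := repr _ in Jg *; set f' := repr _ in Jf *.
have -> : g ∘ f - g' ∘ f' = (g - g') ∘ f + g' ∘ (f - f').
  by rewrite compDl compDr compNl compNr addrA subrK.
by apply: idealD; [apply: idealMr | apply: idealMl].
Qed.

Lemma qcls_linear (X Y : C) : linear (@qcls X Y). Proof. exact: qpi_linear. Qed.

Lemma qcompA (W X Y Z : C) (h : qhom Y Z) (g : qhom X Y) (f : qhom W X) :
  qcomp h (qcomp g f) = qcomp (qcomp h g) f.
Proof. by rewrite -[h]qclsK -[g]qclsK -[f]qclsK -!qclsM compA. Qed.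
Lemma qcomp1m (X Y : C) (f : qhom X Y) : qcomp (qcls (idm Y)) f = f.
Proof. by rewrite -[f]qclsK -qclsM comp1m. Qed.
Lemma qcompm1 (X Y : C) (f : qhom X Y) : qcomp f (qcls (idm X)) = f.
Proof. by rewrite -[f]qclsK -qclsM compm1. Qed.
Lemma qcomp_linl (X Y Z : C) (f : qhom X Y) :
  linear (fun g : qhom Y Z => qcomp g f).
Proof.
move=> a g g'; rewrite -[g]qclsK -[g']qclsK -[f]qclsK -qcls_linear -!qclsM.
by rewrite -qcls_linear compDl compZl.
Qed.
Lemma qcomp_linr (X Y Z : C) (g : qhom Y Z) : linear (@qcomp X Y Z g).
Proof.
move=> a f f'; rewrite -[g]qclsK -[f]qclsK -[f']qclsK -qcls_linear -!qclsM.
by rewrite -qcls_linear compDr compZr.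
Qed.

Definition quot_kcat : kcat k :=
  @KCat k C qhom (fun X => qcls (idm X)) qcomp
    qcompA qcomp1m qcompm1 qcomp_linl qcomp_linr.
End QuotientCategory.

Record functor (k : comPzRingType) (C D : kcat k) := Functor {
  fobj :> C -> D;
  fmap : forall X Y : C, hom X Y -> hom (fobj X) (fobj Y);
  fmap1 : forall X : C, fmap (idm X) = idm (fobj X);
  fmapM : forall (X Y Z : C) (g : hom Y Z) (f : hom X Y),
    fmap (g ∘ f) = fmap g ∘ fmap f }.
Arguments fmap {k C D} _ {X Y} _.

Definition functor_id (k : comPzRingType) (C : kcat k) : functor C C :=
  @Functor k C C (fun X => X) (fun X Y f => f) (fun X => erefl)
    (fun X Y Z g f => erefl).

Lemma functor_comp_subproof1 (k : comPzRingType) (A B C : kcat k)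
  (G : functor B C) (F : functor A B) (X : A) :
  fmap G (fmap F (idm X)) = idm (G (F X)).
Proof. by rewrite !fmap1. Qed.
Lemma functor_comp_subproofM (k : comPzRingType) (A B C : kcat k)
  (G : functor B C) (F : functor A B) (X Y Z : A) (g : hom Y Z) (f : hom X Y) :
  fmap G (fmap F (g ∘ f)) = fmap G (fmap F g) ∘ fmap G (fmap F f).
Proof. by rewrite !fmapM. Qed.
Definition functor_comp (k : comPzRingType) (A B C : kcat k)
    (G : functor B C) (F : functor A B) : functor A C :=
  @Functor k A C (fun X => G (F X)) (fun X Y f => fmap G (fmap F f))
    (functor_comp_subproof1 G F) (functor_comp_subproofM G F).

Definition nat_iso (k : comPzRingType) (C D : kcat k) (F G : functor C D) : Prop :=
  exists eta : forall X : C, hom (F X) (G X),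
    (forall X, is_iso (eta X)) /\
    forall (X Y : C) (f : hom X Y), eta Y ∘ fmap F f = fmap G f ∘ eta X.

Definition quasi_inverse (k : comPzRingType) (C D : kcat k)
    (F : functor C D) (G : functor D C) : Prop :=
  nat_iso (functor_comp G F) (functor_id C) /\
  nat_iso (functor_comp F G) (functor_id D).

Section Stable.
Variables (k : comPzRingType) (C : exactCat k).

Definition proj_trivial (X Y : C) (f : hom X Y) : Prop :=
  forall (Z : C) (x : Ext Y Z), pull f x = 0.
Definition inj_trivial (X Y : C) (f : hom X Y) : Prop :=
  forall (Z : C) (x : Ext Z X), push f x = 0.

Lemma push_linear (X X' Y : C) (f : hom X X') : linear (@push k C X X' Y f).
Proof.
move=> a x y; rewrite [LHS]push_addr; congr ext_add.
change (push f (push (a *: idm X) x) = push (a *: idm X') (push f x)).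
by rewrite !push_push compZr compZl comp1m compm1.
Qed.
Lemma pull_linear (X Y Y' : C) (g : hom Y' Y) : linear (@pull k C X Y Y' g).
Proof. by move=> a x y; rewrite [LHS]pull_addr; congr ext_add; apply: pull_push. Qed.

Lemma pull0l (X Y Y' : C) (x : Ext Y X) : pull (0 : hom Y' Y) x = 0.
Proof. apply: (addrI (pull 0 x)); rewrite addr0.
by have := pull_addl (0 : hom Y' Y) 0 x; rewrite addr0 => /esym. Qed.
Lemma pull0r (X Y Y' : C) (g : hom Y' Y) : pull g (0 : Ext Y X) = 0.
Proof. apply: (addrI (pull g 0)); rewrite addr0.
exact: etrans (esym (pull_addr g 0 0)) (congr1 (pull g) (addr0 (0 : Ext Y X))). Qed.
Lemma push0r (X X' Y : C) (f : hom X X') : push f (0 : Ext Y X) = 0.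
Proof. apply: (addrI (push f 0)); rewrite addr0.
exact: etrans (esym (push_addr f 0 0)) (congr1 (push f) (addr0 (0 : Ext Y X))). Qed.

Definition proj_ideal : ideal C.
Proof.
exists proj_trivial.
- by move=> X Y Z x; apply: pull0l.
- by move=> X Y f g hf hg Z x; rewrite pull_addl hf hg; apply: addr0.
- by move=> X Y Z f g hf W x; rewrite -pull_pull hf.
- by move=> X Y Z f g hg W x; rewrite -pull_pull hg pull0r.
Defined.

Definition inj_ideal : ideal C.
Proof.
exists inj_trivial.
- by move=> X Y Z x; apply: push0.
- by move=> X Y f g hf hg Z x; rewrite push_addl hf hg; apply: addr0.
- by move=> X Y Z f g hf W x; rewrite -push_push hf push0r.
- by move=> X Y Z f g hg W x; rewrite -push_push hg.
Defined.

Definition stab : kcat k := quot_kcat proj_ideal.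
Definition costab : kcat k := quot_kcat inj_ideal.

Definition pcls (X Y : C) (f : hom X Y) : @hom k stab X Y := qcls proj_ideal f.
Definition icls (X Y : C) (f : hom X Y) : @hom k costab X Y := qcls inj_ideal f.

(* In the naturality squares, u : X -> X' and v : Y' -> Y act on Ext^1 by     *)
(* Ext^1(u, v) x = push v (pull u x).                                         *)
Definition AR_duality (E : lmodType k) : Prop :=
  exists (tau : functor stab costab) (taum : functor costab stab),
    quasi_inverse tau taum /\
    (exists phi : forall X Y : C,
        {linear @hom k costab Y (tau X) -> moddual E (Ext X Y)},
      (forall X Y, bijective (phi X Y)) /\
      forall (X X' Y Y' : C) (u : hom X X') (v : hom Y' Y)
          (a : @hom k costab Y (tau X)) (x : Ext X' Y'),
        phi X' Y' (fmap tau (pcls u) ∘ a ∘ icls v) x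
        = phi X Y a (push v (pull u x))) /\
    (exists psi : forall X Y : C,
        {linear @hom k stab (taum Y) X -> moddual E (Ext X Y)},
      (forall X Y, bijective (psi X Y)) /\
      forall (X X' Y Y' : C) (u : hom X X') (v : hom Y' Y)
          (b : @hom k stab (taum Y) X) (x : Ext X' Y'),
        psi X' Y' (pcls u ∘ b ∘ fmap taum (icls v)) x
        = psi X Y b (push v (pull u x))).

Definition factors_through (T X Y : C) (g : hom T Y) (f : hom X Y) : Prop :=
  exists t : hom T X, g = f ∘ t.

Definition right_determined (D X Y : C) (f : hom X Y) : Prop :=
  forall (T : C) (g : hom T Y),
    (forall h : hom D T, factors_through (g ∘ h) f) -> factors_through g f.

(* submodules of Hom(D, Y) over Gamma_D = End(D)^op, acting by precomposition *)
Definition Gamma_submodule (D Y : C) (H : hom D Y -> Prop) : Prop :=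
  [/\ H 0, forall f g, H f -> H g -> H (f + g)
    & forall (f : hom D Y) (e : hom D D), H f -> H (f ∘ e)].

Definition right_stably_determined_deflations : Prop :=
  forall Y : C,
    (forall (X : C) (f : hom X Y), deflation f ->
       exists D : C, right_determined D f) /\
    (forall (D : C) (H : hom D Y -> Prop),
       Gamma_submodule H ->
       (forall f, proj_trivial f -> H f) ->
       exists (X : C) (f : hom X Y),
         [/\ deflation f, right_determined D f &
             forall g : hom D Y, H g <-> exists s : hom D X, f ∘ s = g]).
End Stable.

Definition left_stably_determined_inflations
    (k : comPzRingType) (C : exactCat k) : Prop :=
  right_stably_determined_deflations (op_exactCat C).

(* Main.v *)
Require Import Defs.
From HB Require Import structures.
From mathcomp Require Import all_boot all_algebra.
From mathcomp Require Import boolp classical_sets.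
(* [all_algebra] also exports a [hom]. *)
Import Defs.

Set Implicit Arguments.
Unset Strict Implicit.
Unset Printing Implicit Defensive.

Import GRing.Theory.
Local Open Scope ring_scope.

(* Both duality and determination are compared with the existence of pairs    *)
(* (X, K) together with a functional eta on Ext(X, K) for which the pairings  *)
(* (u, z) |-> eta (u_* z) on costab(Y, K) x Ext(X, Y) and                     *)
(* (g, z) |-> eta (g^* z) on stab(X, Z) x Ext(Z, K) are nondegenerate; then   *)
(* K = tau X.  The notion is self-dual, which gives (2) <-> (3).  By Matlis   *)
(* duality over an artinian ring, nondegenerate pairings with a finitely      *)
(* generated module are perfect, so the pairs assemble into an equivalence    *)
(* stab -> costab, and orthogonals of Gamma-submodules in Ext(Y, tau C)       *)
(* provide the required determined deflations.  Conversely, for X             *)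
(* indecomposable and not projective, a deflation determined by X whose image *)
(* is rad End(X) contains an almost split conflation ending at X, whence a    *)
(* pair (X, K); a deflation determined by D with indecomposable kernel K      *)
(* forces K to be a summand of a power of tau D.                              *)

(** * Submodules and linear maps *)

(** A functional [eta] on Ext(X, K) whose pairings with Hom(Y, K) and Hom(X, Z) are nondegenerate
    modulo trivial morphisms ([AR_pair]) is a pointwise form of Auslander-Reiten duality. Existence
    of such pairs for every X and every K ([has_AR_pairs]) is the condition to which all three
    statements reduce, and it passes to the opposite category ([has_AR_pairs_op]).

    Nondegeneracy suffices because of Matlis duality. The m-socle of the minimal injective
    cogenerator is at most a line ([socle_line]), so a pairing with a finitely generated module can
    be treated one composition factor at a time: functionals are represented ([perfect_pairing]), a
    functional killing the orthogonal of H comes from H ([double_perp]), and submodules of the other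
    side are finitely generated ([submodule_fin_gen]).

    Duality yields pairs by Yoneda ([AR_duality_pairs]). Conversely each morphism has an adjoint
    with respect to the functionals, unique modulo trivial morphisms, and adjoints form a fully
    faithful dense functor ([transpose_duality]). Pairs yield determined deflations by taking
    orthogonals in Ext ([AR_pairs_determined]). Determined deflations yield pairs through almost
    split conflations ([ar_local], [almost_split_pair]); every indecomposable K is reached because a
    deflation with kernel K is determined by some object ([ar_local_sub]). *)

Definition mklin (k : comPzRingType) (U V : lmodType k) (f : U -> V)
    (fL : linear f) : {linear U -> V} :=
  HB.pack f (GRing.isLinear.Build k U V *:%R f fL).

Section Submodules.
Variables (k : comPzRingType) (V : lmodType k).

Lemma smB (W : submodule V) x y : W x -> W y -> W (x - y).
Proof. by move=> Wx Wy; rewrite -scaleN1r; apply/smD/smZ. Qed.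

Definition sm_zero : submodule V.
Proof.
exists (fun x => x = 0) => // [x y -> ->|a x ->]; first by rewrite addr0.
by rewrite scaler0.
Defined.

Definition sm_adjoin (W : submodule V) (s : V) : submodule V.
Proof.
exists (fun x => exists w a, W w /\ x = w + a *: s).
- by exists 0, 0; rewrite scale0r addr0; split=> //; apply: sm0.
- move=> _ _ [w [a [Ww ->]]] [w' [a' [Ww' ->]]]; exists (w + w'), (a + a').
  by split; [apply: smD | rewrite scalerDl addrACA].
- move=> b _ [w [a [Ww ->]]]; exists (b *: w), (b * a).
  by split; [apply: smZ | rewrite scalerDr scalerA].
Defined.

Lemma sm_adjoin_sub (W : submodule V) s x : W x -> sm_adjoin W s x.
Proof. by exists x, 0; rewrite scale0r addr0. Qed.

Lemma sm_adjoin_gen (W : submodule V) s : sm_adjoin W s s.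
Proof. by exists 0, 1; rewrite scale1r add0r; split=> //; apply: sm0. Qed.

Definition sm_ker (U : lmodType k) (f : {linear V -> U}) : submodule V.
Proof.
exists (fun x => f x = 0); first exact: linear0.
  by move=> x y fx fy; rewrite linearD fx fy addr0.
by move=> a x fx; rewrite linearZ /= fx scaler0.
Defined.

Definition sm_im (U : lmodType k) (f : {linear U -> V}) : submodule V.
Proof.
exists (fun x => exists z, x = f z).
- by exists 0; rewrite linear0.
- by move=> _ _ [z ->] [w ->]; exists (z + w); rewrite linearD.
- by move=> a _ [z ->]; exists (a *: z); rewrite linearZ.
Defined.

Lemma orbit_linear (x : V) : linear (fun a : k^o => a *: x).
Proof. by move=> a c d; rewrite scalerDl scalerA. Qed.
Definition orbit_map (x : V) : {linear k^o -> V} := mklin (orbit_linear x).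

Lemma qmod_lift (U : lmodType k) (f : {linear V -> U}) (W : submodule V) :
  (forall x, W x -> f x = 0) ->
  exists g : {linear qmod W -> U}, forall x, g (qpi W x) = f x.
Proof.
move=> fW.
have fr x : f (repr (qpi W x)) = f x.
  by apply/esym/eqP; rewrite -subr_eq0 -linearB fW //; apply: qpi_repr.
have gL : linear (fun z : qmod W => f (repr z)).
  move=> a z z'; rewrite -[z](qreprK (W := W)) -[z'](qreprK (W := W)).
  by rewrite -(qpi_linear W) !fr linearP.
by exists (mklin gL) => x; apply: fr.
Qed.

Lemma qpi0 (W : submodule V) x : qpi W x = 0 <-> W x.
Proof.
have <- : qpi W 0 = 0 by apply: raddf0.
by rewrite qpiP subr0.
Qed.

(* [Zorn_bigcup] needs a property that holds of the empty union, hence the    *)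
(* detour through possibly empty sets.                                        *)
Lemma maximal_submodule (R : V -> V -> Prop) : R 0 0 ->
  exists2 W : submodule V, forall x y, W x -> W y -> R x y &
    forall T : submodule V, (forall x, W x -> T x) ->
      (forall x y, T x -> T y -> R x y) -> forall x, T x -> W x.
Proof.
move=> R00.
pose P (A : set V) := forall x y, A x -> A y ->
  [/\ A (x + y), forall a, A (a *: x) & R x y].
have [|A [PA Amax]] := @Zorn_bigcup V P.
  move=> F FP Ftot x y [A FA Ax] [B FB By].
  have [AB|BA] := Ftot _ _ FA FB.
    have [h1 h2 h3] := FP _ FB _ _ (AB _ Ax) By.
    by split=> [|a|//]; exists B => //; apply: h2.
  have [h1 h2 h3] := FP _ FA _ _ Ax (BA _ By).
  by split=> [|a|//]; exists A => //; apply: h2.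
have A0 : A 0.
  apply: contrapT => nA0; apply: (Amax (fun x => x = 0)).
    split=> [x Ax|/(_ 0 erefl) //]; case: nA0.
    by have [_ /(_ 0) + _] := PA _ _ Ax Ax; rewrite scale0r.
  by move=> _ _ -> ->; split=> [|a|//]; rewrite ?addr0 ?scaler0.
have AZ a x : A x -> A (a *: x) by move=> Ax; have [] := PA _ _ Ax Ax.
have AD x y : A x -> A y -> A (x + y) by move=> Ax Ay; have [] := PA _ _ Ax Ay.
exists (Submodule A0 AD AZ) => [x y /= Ax Ay|T /= AT RT].
  by have [] := PA _ _ Ax Ay.
move=> x Tx; apply: contrapT => nAx; apply: (Amax T) => [|y z Ty Tz].
  by split=> // /(_ x Tx).
by split; [apply: smD | move=> a; apply: smZ | apply: RT].
Qed.

End Submodules.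

Section SubmoduleType.
Variables (k : comPzRingType) (V : lmodType k) (W : submodule V).

Record smtype := SmType { smval : V; smvalP : smval \in sm_pred W }.

Lemma sm_pred_submod : GRing.submod_closed (sm_pred W).
Proof.
split=> [|a x y]; rewrite !sm_predE; first exact/asboolP/sm0.
by move=> /asboolP Wx /asboolP Wy; apply/asboolP/smD => //; apply: smZ.
Qed.
HB.instance Definition _ :=
  GRing.isSubmodClosed.Build k V (sm_pred W) (GRing.submod_closed_semi sm_pred_submod).
HB.instance Definition _ := [isSub for smval].
HB.instance Definition _ := [Choice of smtype by <:].
HB.instance Definition _ := [SubChoice_isSubLmodule of smtype by <:].

Lemma smtype_in (x : smtype) : W (val x).
Proof. by apply/asboolP; rewrite -sm_predE; apply: valP. Qed.

Lemma smtype_ex (x : V) : W x -> exists y : smtype, val y = x.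
Proof.
by move=> /asboolP; rewrite -sm_predE => Wx; exists (SmType Wx).
Qed.
End SubmoduleType.

(** * Artinian rings and the minimal injective cogenerator *)

(** Maximality in the form in which it is used: the residue ring k/m is a field, so every [a]
    outside [m] is invertible modulo [m]. *)
Definition maximal_ideal (k : comPzRingType) (m : submodule k^o) : Prop :=
  ~ m 1 /\ forall a, ~ m a -> exists b, m (1 - b * a).

Lemma maximal_idealE (k : comPzRingType) (m : submodule k^o) a :
  maximal_ideal m -> ~ m a -> exists b, forall (M : lmodType k) (W : submodule M) x,
    (forall c, m c -> W (c *: x)) -> W (x - b *: (a *: x)).
Proof.
move=> [_ mm] /mm[b mb]; exists b => M W x /(_ _ mb).
by rewrite scalerBl scale1r scalerA.
Qed.

Lemma maximal_ideal_inv (k : comPzRingType) (m : submodule k^o) a :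
  maximal_ideal m -> ~ m a -> exists b, forall (M : lmodType k) (x : M),
    (forall c, m c -> c *: x = 0) -> b *: (a *: x) = x.
Proof.
move=> mm /(maximal_idealE mm)[b bP]; exists b => M x mx.
by apply/esym/eqP; rewrite -subr_eq0; apply/eqP; apply: (bP _ (sm_zero M)).
Qed.

Section Artinian.
Variables (k : comPzRingType).
Hypothesis k_art : artinian k.

(** Without a minimal member, iterated choice would give an infinite strictly descending sequence of
    ideals. *)
Lemma artinian_min (P : submodule k^o -> Prop) I0 : P I0 ->
  exists2 I, P I & forall J, P J -> (forall x, J x -> I x) ->
    forall x, I x -> J x.
Proof.
move=> PI0; apply: contrapT => nex.
have step (I : {I | P I}) : {J : {J | P J} |
    (forall x, sval J x -> sval I x) /\ exists2 x, sval I x & ~ sval J x}.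
  apply: cid; case: I => I PI; apply: contrapT => nJ; apply: nex.
  exists I => // J PJ JI x Ix; apply: contrapT => nJx; apply: nJ.
  by exists (exist _ J PJ); split=> //; exists x.
pose I n := iter n (fun I => sval (step I)) (exist _ I0 PI0).
have [||N NP] := k_art (I := fun n => sval (I n)).
- move=> n; case: (I n) => J _ /=; split; first exact: (sm0 J).
    exact: (smD (s := J)).
  exact: (smZ (s := J)).
- by move=> n x; have [+ _] := svalP (step (I n)); apply.
have [_ [x Ix nIx]] := svalP (step (I N)).
by apply: nIx; apply/(NP N.+1).
Qed.

(** Every nonzero cyclic module contains a simple one: take [b] generating a minimal principal ideal
    that does not kill [x]. If [a] does not kill [b *: x], the ideal of [a * b] is again such an
    ideal, so minimality makes [a] invertible modulo the annihilator of [b *: x]. *)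
Lemma simple_multiple (M : lmodType k) (x : M) : x <> 0 ->
  exists b (m : submodule k^o), [/\ maximal_ideal m, b *: x <> 0 &
    forall a, m a -> a *: (b *: x) = 0].
Proof.
move=> x0.
pose prin (b : k) := sm_im (orbit_map (b : k^o)).
have [|I [b bx Ib] Imin] := @artinian_min
    (fun I => exists2 b, b *: x <> 0 & forall y, I y <-> prin b y) (prin 1).
  by exists 1; rewrite ?scale1r.
exists b, (sm_ker (orbit_map (b *: x))); split=> //; split=> [/=|a /= nax].
  by rewrite scale1r.
have nabx : (a * b) *: x <> 0 by rewrite -scalerA.
have [||| c bE] := Imin (prin (a * b)) _ _ b.
- by exists (a * b).
- by move=> y [c ->]; apply/Ib; exists (c * a); apply: mulrA.
- by apply/Ib; exists 1; rewrite /= scale1r.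
have {}bE : b = c * a * b by rewrite {1}bE; apply: mulrA.
by exists c; rewrite /= scalerA mulrBl mul1r -bE subrr scale0r.
Qed.

(** * The socle of the minimal injective cogenerator *)

Section Matlis.
Variable E : lmodType k.
Hypothesis E_min : minimal_injective_cogenerator E.

Let E_inj : injective_module E. Proof. by case: E_min => -[]. Qed.
Let E_cog : cogenerator E. Proof. by case: E_min => -[]. Qed.

(** [f] induces an embedding of its coimage and [g] factors through that coimage, so injectivity of
    [E] applies. *)
Lemma linear_extension (U V : lmodType k) (f : {linear U -> V})
    (g : {linear U -> E}) : (forall x, f x = 0 -> g x = 0) ->
  exists h : {linear V -> E}, forall x, h (f x) = g x.
Proof.
move=> fg.
have [f' f'E] := @qmod_lift k U V f (sm_ker f) (fun x => id).
have [g' g'E] := @qmod_lift k U E g (sm_ker f) fg.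
have [|h hE] := E_inj (i := f') g'.
  move=> z z'; rewrite -[z]qreprK -[z']qreprK !f'E => e; apply/qpiP => /=.
  by rewrite linearB e subrr.
by exists h => x; rewrite -f'E hE g'E.
Qed.

(* A submodule N of E maximal for having one-dimensional simple isotypic      *)
(* socles is a direct summand; for a complement K of N, E / K is an injective *)
(* cogenerator with the same property, and E embeds into it.                  *)
Lemma socle_line (m : submodule k^o) (x y : E) : maximal_ideal m ->
  (forall a, m a -> a *: x = 0) -> (forall a, m a -> a *: y = 0) ->
  x <> 0 -> exists a, y = a *: x.
Proof.
move: m x y.
have [|N Nline Nmax] := @maximal_submodule k E (fun x y =>
    forall m : submodule k^o, maximal_ideal m -> (forall a, m a -> a *: x = 0) ->
    (forall a, m a -> a *: y = 0) -> x <> 0 -> exists a, y = a *: x).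
  by move=> m _ _ _ [].
have [|K KN Kmax] := @maximal_submodule k E (fun x _ => N x -> x = 0); first by [].
have {}KN x : K x -> N x -> x = 0 by move=> h; apply: (KN _ _ h h).
pose pi : {linear E -> qmod K} := mklin (qpi_linear K).
have piE x : pi x = qpi K x by [].
have piN : injective (pi \o (val : smtype N -> E) : {linear _ -> _}).
  move=> x y /qpiP e; apply: val_inj; apply/eqP.
  rewrite -subr_eq0; apply/eqP/KN => //.
  by apply: smB; apply: smtype_in.
have [g gN'] := E_inj (val : {linear smtype N -> E}) piN.
have gN n : N n -> g (pi n) = n by move=> /smtype_ex[x <-]; apply: gN'.
have meet e : ~ K e -> exists c n, [/\ N n, n <> 0 & n = c *: g (pi e)].
  move=> nKe; apply: contrapT => nex; apply: nKe.
  apply: (Kmax (sm_adjoin K e)); [exact: sm_adjoin_sub| |exact: sm_adjoin_gen].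
  move=> x _ [w [c [Kw ->]]] _ Nx; apply: contrapT => x0; apply: nex.
  exists c, (w + c *: e); split=> //.
  by rewrite -[LHS]gN // linearD (_ : pi w = 0) ?add0r ?linearZ //; apply/qpi0.
have ginj : injective g.
  suff g0 z : g z = 0 -> z = 0.
    move=> z w e; apply/eqP; rewrite -subr_eq0; apply/eqP/g0.
    by rewrite linearB e subrr.
  rewrite -[z]qreprK => gz; apply/qpi0; apply: contrapT => /meet[c [n [_ n0 nE]]].
  by apply: n0; rewrite nE piE gz scaler0.
pose G := sm_im g.
have socG (m : submodule k^o) x : maximal_ideal m -> G x ->
    (forall a, m a -> a *: x = 0) -> N x.
  move=> mm [z ->]; rewrite -[z]qreprK => mx.
  have [/qpi0 -> |/meet[c [n [Nn n0 nE]]]] := EM (K (repr z)).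
    by rewrite linear0; apply: sm0.
  have [|b bP] := @maximal_ideal_inv _ m c mm.
    by move=> /mx e; apply: n0; rewrite nE piE.
  by rewrite -(bP _ _ mx) -piE -nE; apply: smZ.
(* Socle elements of [G] already lie in [N], so [G] inherits the defining property of [N]; since [G]
   contains [N], maximality makes them equal. *)
have GN x : G x -> N x.
  apply: Nmax => [y Ny|y w Gy Gw m mm my mw y0]; first by exists (pi y); rewrite gN.
  exact: (Nline _ _ (socG _ _ mm Gy my) (socG _ _ mm Gw mw) m).
have pig z : pi (g z) = z by apply: ginj; rewrite gN //; apply: GN; exists z.
(* [N] contains a copy of each k/m: otherwise an element [s] of [E] spanning such a copy could be
   adjoined to [N] without losing its property. *)
have resN (m : submodule k^o) : maximal_ideal m ->
    exists s, [/\ N s, s <> 0 & forall a, m a -> a *: s = 0].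
  move=> mm.
  have m1 : qpi m (1 : k^o) <> 0 by move/qpi0; case: mm.
  have [f f1] := E_cog m1.
  set s := f _ in f1.
  have ms a : m a -> a *: s = 0.
    move=> ma; have e : (a : k) *: qpi m (1 : k^o) = 0.
      apply: etrans (esym (qpiZ m a 1)) _; apply/qpi0.
      by rewrite /GRing.scale /= mulr1.
    by rewrite /s -linearZ e linear0.
  apply: contrapT => nex.
  have N0 n : N n -> (forall a, m a -> a *: n = 0) -> n = 0.
    by move=> Nn mn; apply: contrapT => n0; apply: nex; exists n.
  apply: (f1); apply: (N0) => //; apply: (Nmax (sm_adjoin N s)); last first.
  - exact: sm_adjoin_gen.
  - move=> _ _ [n1 [a1 [Nn1 ->]]] [n2 [a2 [Nn2 ->]]] m' mm' mx my x0.
    have mb n a b : m b -> b *: (n + a *: s) = b *: n.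
      by move=> mb; rewrite scalerDr scalerA mulrC -scalerA ms // scaler0 addr0.
    (* An element [b] of [m] outside [m'] acts invertibly on what [m'] kills and carries it into
       [N]. If there is none, [n1] and [n2] are killed by [m], hence zero, and only multiples of [s]
       are left. *)
    have [[b [mb' nb]]|mm'E] := EM (exists b, m b /\ ~ m' b).
      have [c cP] := maximal_ideal_inv mm' nb.
      apply: (Nline _ _ _ _ m') => //.
        by rewrite -(cP _ _ mx) mb //; do 2!apply: smZ.
      by rewrite -(cP _ _ my) mb //; do 2!apply: smZ.
    have sub b : m b -> m' b.
      by move=> mb'; apply: contrapT => nb; apply: mm'E; exists b.
    have n10 : n1 = 0 by apply: (N0) => // b mb'; rewrite -(mb _ a1) // mx //; apply: sub.
    have n20 : n2 = 0 by apply: (N0) => // b mb'; rewrite -(mb _ a2) // my //; apply: sub.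
    move: x0; rewrite n10 n20 !add0r => x0.
    have na1 : ~ m a1 by move=> /ms.
    have [c cP] := maximal_ideal_inv mm na1.
    by exists (a2 * c); rewrite -scalerA cP.
  - by move=> x; apply: sm_adjoin_sub.
have Q_inj : injective_module (qmod K).
  move=> A B i f iinj; have [h hE] := E_inj (g \o f : {linear _ -> _}) iinj.
  by exists (pi \o h : {linear _ -> _}) => x; rewrite -[RHS]pig -[g (f x)]hE.
(* A nonzero value in [E] has a multiple spanning a copy of k/m; this copy is sent onto the one
   given by [resN], and the map is extended to [E] by injectivity of the quotient. *)
have Q_cog : cogenerator (qmod K).
  move=> M x x0; have [f0 f0x] := E_cog x0.
  have [b [m [mm bx mbx]]] := simple_multiple f0x.
  have [s [Ns s0 ms]] := resN m mm.
  have [i iE] := @qmod_lift _ _ _ (orbit_map (b *: f0 x)) m mbx.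
  have [|f fE] := @qmod_lift _ _ _ (orbit_map (pi s)) m.
    by move=> a ma; rewrite -[RHS](linear0 pi) -(ms a ma) linearZ.
  have [|h hE] := Q_inj _ _ i f.
    move=> z z'; rewrite -[z]qreprK -[z']qreprK !iE /= => e; apply/qpiP.
    apply: contrapT => nm.
    have [c cP] := maximal_ideal_inv mm nm.
    by apply: bx; rewrite -[LHS](cP _ _ mbx) scalerBl e subrr; apply: scaler0.
  exists (h \o f0 : {linear _ -> _}) => /= e.
  have := hE (qpi m (1 : k^o)); rewrite iE fE [orbit_map _ _]scale1r.
  rewrite [orbit_map _ _]scale1r linearZ_LR e scaler0 => /esym e'.
  by apply: s0; rewrite -[s]gN // e' linear0.
have [j jinj] := E_min.2 _ (conj Q_inj Q_cog).
move=> m x y mm mx my x0.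
have mgj w : (forall a, m a -> a *: w = 0) -> forall a, m a -> a *: g (j w) = 0.
  by move=> mw a ma; rewrite -!linearZ mw // !linear0.
have Ngj w : N (g (j w)) by apply: GN; exists (j w).
have [| | | | |e eE] := Nline (g (j x)) (g (j y)) _ _ m mm => //.
- exact: mgj.
- exact: mgj.
- by rewrite -[0](linear0 g) -(linear0 j) => /ginj/jinj.
by exists e; apply/jinj/ginj; rewrite eE !linearZ.
Qed.

(** * Finite length of finitely generated modules *)

(** A filtration from [S] to [T] whose factors are cyclic and killed by a maximal ideal, hence
    simple or zero. Zero factors are allowed so that no strictness has to be maintained. *)
Inductive comp_chain (M : lmodType k) (S : submodule M) : submodule M -> Prop :=
| CompNil (T : submodule M) : (forall x, S x <-> T x) -> comp_chain S T
| CompCons (T T' : submodule M) (m : submodule k^o) x :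
    comp_chain S T -> maximal_ideal m ->
    (forall a, m a -> T (a *: x)) -> (forall y, T' y <-> sm_adjoin T x y) ->
    comp_chain S T'.

Lemma comp_chain_eqr (M : lmodType k) (S T U : submodule M) :
  comp_chain S T -> (forall x, T x <-> U x) -> comp_chain S U.
Proof.
move=> [T' ST'|T' T'' m x ST' mm mx T'E] TU.
  by apply: CompNil => x; rewrite ST' TU.
by apply: CompCons ST' mm mx _ => y; rewrite -TU T'E.
Qed.

Lemma comp_chain_trans (M : lmodType k) (S T U : submodule M) :
  comp_chain S T -> comp_chain T U -> comp_chain S U.
Proof.
move=> ST; elim=> [U' TU'|U' U'' m x _ SU' mm mx U''E].
  exact: comp_chain_eqr TU'.
exact: CompCons SU' mm mx U''E.
Qed.

Definition sm_full (M : lmodType k) : submodule M :=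
  @Submodule k M (fun=> True) I (fun _ _ _ _ => I) (fun _ _ _ => I).

(** Let [I] be minimal among the ideals joined to k by a chain, and suppose it is nonzero. Choose
    [b] not annihilating [I] with [m] times [b] annihilating it. For a functional [f] into [E], the
    map sending z to f(bz) takes [I] into the m-socle of [E], which is a line by [socle_line]. Its
    kernel [J] on [I] is thus one step below [I], a contradiction. *)
Lemma comp_chain_regular : comp_chain (sm_zero k^o) (sm_full k^o).
Proof.
have [|I Ifull Imin] := @artinian_min (fun I => comp_chain I (sm_full k^o)) (sm_full k^o).
  exact: CompNil.
apply: (comp_chain_trans _ Ifull); apply: CompNil => x; split=> [->|Ix].
  exact: sm0.
apply: contrapT => x0.
have ann0 : forall y, I y -> 0 * y = 0 by move=> y _; rewrite mul0r.
have annD a b : (forall y, I y -> a * y = 0) -> (forall y, I y -> b * y = 0) ->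
    forall y, I y -> (a + b) * y = 0.
  by move=> ha hb y Iy; rewrite mulrDl ha ?hb ?addr0.
have annZ a b : (forall y, I y -> b * y = 0) -> forall y, I y -> (a * b) * y = 0.
  by move=> hb y Iy; rewrite -mulrA hb ?mulr0.
pose ann := @Submodule k k^o (fun a => forall y, I y -> a * y = 0) ann0 annD annZ.
have ann1 : qpi ann (1 : k^o) <> 0.
  by move=> /qpi0/(_ _ Ix); rewrite mul1r.
have qE a b : (a : k) *: qpi ann (b : k^o) = qpi ann (a * b : k^o).
  exact/esym/(qpiZ ann).
have [b [m [mm]]] := simple_multiple ann1.
rewrite qE mulr1 => /qpi0 nb mb.
have [y Iy by0] : exists2 y, I y & b * y <> 0.
  apply: contrapT => nex; apply: nb => y Iy; apply: contrapT => by0.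
  by apply: nex; exists y.
have {}mb a z : m a -> I z -> a * (b * z) = 0.
  by move=> /mb; rewrite qE => /qpi0 /= + Iz => /(_ z Iz); rewrite mulrA.
have [f fy] := @E_cog k^o (b * y : k^o) by0.
have fb a z : f (b * (a * z) : k^o) = a *: f (b * z : k^o).
  by rewrite mulrCA -linearZ_LR.
have J0 : I 0 /\ f (b * 0 : k^o) = 0.
  by split; [apply: sm0 | rewrite mulr0 linear0].
have JD z w : I z /\ f (b * z : k^o) = 0 -> I w /\ f (b * w : k^o) = 0 ->
    I (z + w) /\ f (b * (z + w) : k^o) = 0.
  move=> [Iz fz] [Iw fw]; split; first exact: smD.
  by rewrite mulrDr linearD fz fw addr0.
have JZ a z : I z /\ f (b * z : k^o) = 0 -> I (a * z) /\ f (b * (a * z) : k^o) = 0.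
  move=> [Iz fz]; split; last by rewrite fb fz scaler0.
  exact (smZ (a : k) Iz).
pose J := @Submodule k k^o (fun z => I z /\ f (b * z : k^o) = 0) J0 JD JZ.
have mf a z : m a -> I z -> a *: f (b * z : k^o) = 0.
  by move=> ma Iz; rewrite -linearZ_LR [_ *: _]mb ?linear0.
have [||_ /fy//] := Imin J _ _ y Iy.
  apply: (comp_chain_trans _ Ifull).
  apply: (CompCons (m := m) (x := y) (CompNil (fun=> iff_refl _)) mm).
    by move=> a ma; split; [apply: smZ | rewrite fb mf].
  move=> z; split=> [Iz|[w [a [[Iw _] ->]]]]; last by apply: smD => //; apply: smZ.
  have [||//|c cE] := socle_line mm (x := f (b * y : k^o)) (y := f (b * z : k^o)).
  - by move=> a ma; apply: mf.
  - by move=> a ma; apply: mf.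
  exists (z - c * y), c; split; last by rewrite [c *: y]/GRing.scale /= subrK.
  split; first by apply: smB => //; apply: (smZ c Iy).
  by rewrite mulrBr linearB fb cE subrr.
by move=> z [].
Qed.

(** Each new generator v carries the chain of the regular module to the chain of the submodules T +
    I v. *)
Lemma comp_chain_fin_gen (M : lmodType k) : fin_gen M ->
  exists2 T : submodule M, comp_chain (sm_zero M) T & forall x, T x.
Proof.
move=> [n [v vP]].
have [T ch Tv] : exists2 T : submodule M, comp_chain (sm_zero M) T & forall i, T (v i).
  elim: n v {vP} => [|n IHn] v.
    by exists (sm_zero M) => [|[]//]; apply: CompNil.
  have [T ch Tv] := IHn (fun i => v (lift ord0 i)).
  have W0 (I : submodule k^o) : exists w a, [/\ T w, I a & 0 = w + a *: v ord0].
    by exists 0, 0; rewrite scale0r addr0; split=> //; apply: sm0.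
  have WD (I : submodule k^o) x y :
      (exists w a, [/\ T w, I a & x = w + a *: v ord0]) ->
      (exists w a, [/\ T w, I a & y = w + a *: v ord0]) ->
      exists w a, [/\ T w, I a & x + y = w + a *: v ord0].
    move=> [w [a [Tw Ia ->]]] [w' [a' [Tw' Ia' ->]]]; exists (w + w'), (a + a').
    by split; [apply: smD | apply: (smD Ia Ia') | rewrite scalerDl addrACA].
  have WZ (I : submodule k^o) b x :
      (exists w a, [/\ T w, I a & x = w + a *: v ord0]) ->
      exists w a, [/\ T w, I a & b *: x = w + a *: v ord0].
    move=> [w [a [Tw Ia ->]]]; exists (b *: w), (b * a).
    by split; [apply: smZ | apply: (smZ b Ia) | rewrite scalerDr scalerA].
  pose W I := Submodule (W0 I) (WD I) (WZ I).
  have chW I J : comp_chain I J -> comp_chain (W I) (W J).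
    elim=> [J' IJ'|J' J'' m x _ IH mm mx J''E].
      apply: CompNil => x; split=> -[w [a [Tw Ia ->]]]; exists w, a;
        by split=> //; apply/IJ'.
    apply: (CompCons (x := x *: v ord0) IH mm) => [a ma|y].
      by exists 0, (a * x); rewrite add0r scalerA; split; [apply: sm0|apply: mx|].
    split=> [[w [a [Tw /J''E[j [c [Jj ->]]] ->]]]|].
      exists (w + j *: v ord0), c; split; first by exists w, j.
      by rewrite scalerDl addrA scalerA.
    move=> [_ [c [[w [j [Tw Jj ->]]] ->]]]; exists w, (j + c * x).
    split=> //; first by apply/J''E; exists j, c.
    by rewrite scalerDl addrA scalerA.
  exists (W (sm_full _)).
    apply: (comp_chain_trans ch).
    apply: (comp_chain_trans _ (chW _ _ comp_chain_regular)).
    apply: CompNil => x; split=> [Tx|[w [_ [Tw -> ->]]]].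
      by exists x, 0; rewrite scale0r addr0.
    by rewrite scale0r addr0.
  move=> i; case: (unliftP ord0 i) => [j|] ->.
    by exists (v (lift ord0 j)), 0; rewrite scale0r addr0.
  by exists 0, 1; rewrite scale1r add0r; split=> //; apply: sm0.
exists T => // x; have [a ->] := vP x.
by elim/big_ind: _ => [|y z|i _]; [apply: sm0 | apply: smD | apply: smZ].
Qed.

(** * Pairings with a finitely generated module *)

Section Pairing.
Variables (N V : lmodType k) (B : N -> V -> E).
Hypothesis N_fg : fin_gen N.
Hypothesis B_linl : forall v, linear (B^~ v).
Hypothesis B_linr : forall n, linear (B n).

Let Bl v : {linear N -> E} := mklin (B_linl v).
Let Br n : {linear V -> E} := mklin (B_linr n).
Let B0l v : B 0 v = 0. Proof. exact: (linear0 (Bl v)). Qed.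
Let BDl n n' v : B (n + n') v = B n v + B n' v. Proof. exact: (linearD (Bl v)). Qed.
Let BZl a n v : B (a *: n) v = a *: B n v. Proof. exact: (linearZ_LR (Bl v)). Qed.
Let BDr n v v' : B n (v + v') = B n v + B n v'. Proof. exact: (linearD (Br n)). Qed.
Let BZr a n v : B n (a *: v) = a *: B n v. Proof. exact: (linearZ_LR (Br n)). Qed.

(** Induction along a chain in [N], with H cut down to its part in the current term. A step either
    adds nothing or adds one element [h]. On the orthogonal [U] of the previous part, both [theta]
    and pairing with [h] take values in one socle line, and [theta] vanishes wherever the pairing
    with [h] does; so they are proportional on [U], and subtracting the multiple reduces to the
    previous term. *)
Lemma double_perp (H : submodule N) (theta : {linear V -> E}) :
  (forall v, (forall n, H n -> B n v = 0) -> theta v = 0) ->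
  exists2 n, H n & forall v, theta v = B n v.
Proof.
have [T ch Tfull] := comp_chain_fin_gen N_fg.
suff : forall theta : {linear V -> E},
    (forall v, (forall n, H n -> T n -> B n v = 0) -> theta v = 0) ->
    exists n, [/\ H n, T n & forall v, theta v = B n v].
  move=> h th0; have [|n [Hn _ nE]] := h theta; last by exists n.
  by move=> v hv; apply: th0 => n Hn; apply: hv.
elim: ch {theta Tfull} => [{}T TE|{}T T' m x _ IH mm mx T'E] theta th0.
  exists 0; split; [exact: sm0|exact/TE|move=> v].
  by rewrite B0l th0 // => n _ /TE ->.
have T'T n : T n -> T' n by move=> Tn; apply/T'E/sm_adjoin_sub.
have [[h [Hh /T'E[t [a [Tt hE]]] nTh]]|nex] := EM (exists h, [/\ H h, T' h & ~ T h]);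
    last first.
  have [|n [Hn Tn nE]] := IH theta; last by exists n; split=> //; apply: T'T.
  move=> v hv; apply: th0 => n Hn T'n; apply: hv => //; apply: contrapT => nT.
  by apply: nex; exists n.
have nma : ~ m a by move=> ma; apply: nTh; rewrite hE; apply: smD => //; apply: mx.
have mh c : m c -> T (c *: h).
  move=> mc; rewrite hE scalerDr scalerA mulrC -scalerA.
  by apply: smD; [apply: smZ | apply/smZ/mx].
have [b bP] := maximal_idealE mm nma.
pose U (v : V) := forall n, H n -> T n -> B n v = 0.
have UZ c v : U v -> U (c *: v) by move=> Uv n Hn Tn; rewrite BZr Uv ?scaler0.
have mBh c v : m c -> U v -> c *: B h v = 0.
  by move=> mc Uv; rewrite -BZl Uv //; [apply: smZ | apply: mh].
have thU v : U v -> B h v = 0 -> theta v = 0.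
  move=> Uv hv; apply: th0 => n Hn /T'E[t' [a' [Tt' nE]]].
  rewrite -[n](subrK ((a' * b) *: h)) BDl BZl hv scaler0 addr0.
  apply: Uv; first by apply: smB => //; apply: smZ.
  have -> : n - (a' * b) *: h = (t' - (a' * b) *: t) + a' *: (x - b *: (a *: x)).
    rewrite nE hE !scalerDr scalerN -!scalerA opprD addrACA.
    by rewrite -!addrA; congr (_ + _); rewrite addrCA.
  by apply: smD; [apply: smB => //; apply: smZ | apply/smZ/bP].
have [[v0 [Uv0 s0]]|nex] := EM (exists v0, U v0 /\ B h v0 <> 0); last first.
  have [|n [Hn Tn nE]] := IH theta; last by exists n; split=> //; apply: T'T.
  move=> v Uv; apply: thU => //; apply: contrapT => Bhv; apply: nex.
  by exists v.
have [||//|d dE] := socle_line mm (x := B h v0) (y := theta v0).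
- by move=> c mc; apply: mBh.
- move=> c mc; rewrite -linearZ_LR thU ?BZr ?mBh //; exact: UZ.
have phL : linear (fun v => theta v - d *: B h v).
  move=> c v v'; rewrite linearP BDr BZr scalerDr opprD addrACA scalerBr.
  by rewrite !scalerA [d * c]mulrC.
have [|n [Hn Tn nE]] := IH (mklin phL).
  move=> v Uv /=; have [||//|e eE] := socle_line mm (x := B h v0) (y := B h v).
  - by move=> c mc; apply: mBh.
  - by move=> c mc; apply: mBh.
  have : theta (v - e *: v0) = 0.
    apply: thU; last by rewrite -scaleNr BDr BZr eE scaleNr subrr.
    move=> n Hn Tn; rewrite -scaleNr BDr BZr Uv // Uv0 //.
    by rewrite scaler0 addr0.
  rewrite linearB linearZ_LR dE => /eqP; rewrite subr_eq0 => /eqP ->.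
  by rewrite eE !scalerA mulrC subrr.
exists (n + d *: h); split.
- by apply: smD => //; apply: smZ.
- by apply: smD; [apply: T'T | apply/smZ/T'E; exists t, a].
by move=> v; rewrite BDl BZl -nE /= subrK.
Qed.

Hypothesis B_nondeg : forall v, v <> 0 -> exists n, B n v <> 0.

Lemma perfect_pairing (theta : {linear V -> E}) :
  exists n, forall v, theta v = B n v.
Proof.
have [|n _ nE] := @double_perp (sm_full N) theta; last by exists n.
move=> v hv; suff -> : v = 0 by apply: linear0.
by apply: contrapT => /B_nondeg[n]; apply; apply: hv.
Qed.

(** [V] embeds into the dual of [N]. Intersecting [U] with the orthogonals of a chain in [N] filters
    it, and by [socle_line] each step costs at most one generator. *)
Lemma submodule_fin_gen (U : submodule V) :
  exists n (v : 'I_n -> V), (forall i, U (v i)) /\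
    forall x, U x -> exists a : 'I_n -> k, x = \sum_i a i *: v i.
Proof.
have [T ch Tfull] := comp_chain_fin_gen N_fg.
pose P (S : submodule N) x := U x /\ forall n, S n -> B n x = 0.
pose fg (S : submodule N) := exists n (v : 'I_n -> V), (forall i, P S (v i)) /\
    forall x, P S x -> exists a : 'I_n -> k, x = \sum_i a i *: v i.
suff : fg T -> fg (sm_zero N).
  case=> [|n [v [vP vgen]]].
    exists 0, (fun=> 0); split=> [[]//|x [Ux Bx]]; exists (fun=> 0).
    rewrite big_ord0; apply: contrapT => /B_nondeg[n]; apply; exact: Bx.
  exists n, v; split=> [i|x Ux]; first by have [] := vP i.
  by apply: vgen; split=> // _ ->.
elim: ch {Tfull} => [{}T TE|{}T T' m x _ IH mm mx T'E].
  move=> [n [v [vP vgen]]]; exists n, v; split=> [i|x [Ux Bx]].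
    by have [Uv Bv] := vP i; split=> // y /TE; apply: Bv.
  by apply: vgen; split=> // y /TE; apply: Bx.
move=> [n [v [vP vgen]]]; apply: IH.
have PT y : P T y -> B x y = 0 -> P T' y.
  move=> [Uy By] Bxy; split=> // _ /T'E[t [a [Tt ->]]].
  by rewrite BDl BZl Bxy scaler0 addr0 By.
have TP y : P T' y -> P T y.
  by move=> [Uy By]; split=> // t Tt; apply/By/T'E/sm_adjoin_sub.
have mB c y : m c -> P T y -> c *: B x y = 0.
  by move=> mc [Uy By]; rewrite -BZl By //; apply: mx.
have [[y0 [Py0 By0]]|nex] := EM (exists y0, P T y0 /\ B x y0 <> 0); last first.
  exists n, v; split=> [i|y Py]; first exact: TP.
  by apply: vgen; apply: PT => //; apply: contrapT => Bxy; apply: nex; exists y.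
pose w (i : 'I_n.+1) := if unlift ord0 i is Some j then v j else y0.
exists n.+1, w; split=> [i|y Py].
  by rewrite /w; case: unliftP => [j _|_] //; apply: TP.
have [||//|e eE] := socle_line mm (x := B x y0) (y := B x y).
- by move=> c mc; apply: mB.
- by move=> c mc; apply: mB.
have [|a aE] := vgen (y - e *: y0).
  apply: PT; last by rewrite -scaleNr BDr BZr eE scaleNr subrr.
  have [[Uy By] [Uy0 By0']] := (Py, Py0); split; first by apply: smB => //; apply: smZ.
  by move=> t Tt; rewrite -scaleNr BDr BZr By ?By0' // scaler0 addr0.
exists (fun i => if unlift ord0 i is Some j then a j else e).
rewrite big_ord_recl /w unlift_none -[y in LHS](subrK (e *: y0)) aE addrC.
by congr (_ + _); apply: eq_bigr => i _; rewrite liftK.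
Qed.

End Pairing.
End Matlis.
End Artinian.

(** * Extensions in exact categories *)

Section Extensions.
Variables (k : comPzRingType) (C : exactCat k).
Implicit Types X Y Z T K : C.

HB.instance Definition _ X X' Y (f : hom X X') :=
  GRing.isLinear.Build k (Ext Y X) (Ext Y X') _ (@push k C X X' Y f)
    (@push_linear k C X X' Y f).
HB.instance Definition _ X Y Y' (g : hom Y' Y) :=
  GRing.isLinear.Build k (Ext Y X) (Ext Y' X) _ (@pull k C X Y Y' g)
    (@pull_linear k C X Y Y' g).

Lemma pushDl X X' Y (f f' : hom X X') (x : Ext Y X) :
  push (f + f') x = push f x + push f' x.
Proof. exact: push_addl. Qed.

Lemma pushZl X X' Y a (f : hom X X') (x : Ext Y X) :
  push (a *: f) x = a *: push f x.
Proof. by rewrite -[f in LHS]comp1m -compZl -push_push. Qed.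

Lemma pullDl X Y Y' (g g' : hom Y' Y) (x : Ext Y X) :
  pull (g + g') x = pull g x + pull g' x.
Proof. exact: pull_addl. Qed.

Lemma pull_scalar X Y a (x : Ext Y X) : pull (a *: idm Y) x = a *: x.
Proof.
apply/esym/mor_eq; rewrite -[x]repK; apply: cmor_cl; exists (a *: idm _).
by rewrite !compZl !compZr !comp1m !compm1.
Qed.

Lemma pullZl X Y Y' a (g : hom Y' Y) (x : Ext Y X) :
  pull (a *: g) x = a *: pull g x.
Proof. by rewrite -[g in LHS]compm1 -compZr -pull_pull pull_scalar. Qed.

Lemma push_lin X X' Y (x : Ext Y X) : linear (fun f : hom X X' => push f x).
Proof. by move=> a f f'; rewrite pushDl pushZl. Qed.
Lemma pull_lin X Y Y' (x : Ext Y X) : linear (fun g : hom Y' Y => pull g x).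
Proof. by move=> a f f'; rewrite pullDl pullZl. Qed.

Lemma push_suml X X' Y n (f : 'I_n -> hom X X') (x : Ext Y X) :
  push (\sum_i f i) x = \sum_i push (f i) x.
Proof. exact: (linear_sum (mklin (@push_lin X X' Y x))). Qed.
Lemma pull_suml X Y Y' n (g : 'I_n -> hom Y' Y) (x : Ext Y X) :
  pull (\sum_i g i) x = \sum_i pull (g i) x.
Proof. exact: (linear_sum (mklin (@pull_lin X Y Y' x))). Qed.

Lemma mor_cmor X Y X' Y' (f : hom X X') (g : hom Y Y')
    (c : conflation Y X) (c' : conflation Y' X') :
  mor f g (cl c) (cl c') -> cmor f g c c'.
Proof.
have e X0 Y0 (c0 c1 : conflation Y0 X0) : cl c0 = cl c1 -> cmor (idm _) (idm _) c0 c1.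
  by move=> /clP[h [_ h1 h2]]; exists h; rewrite compm1 comp1m.
move=> m; rewrite -[f]comp1m -[g]comp1m -[idm X' ∘ f]compm1 -[idm Y' ∘ g]compm1.
apply: cmor_comp; first by apply: (e _ _ c (rep (cl c))); rewrite repK.
by apply: cmor_comp m _; apply: e; rewrite repK.
Qed.

(** A section of the pulled back conflation is the same as a lift of [g] to the middle term. Through
    this, factorization through a deflation becomes a vanishing condition in Ext. *)
Lemma pull_eq0 X Y T (c : conflation Y X) (g : hom T Y) :
  pull g (cl c) = 0 <-> factors_through g (c_def c).
Proof.
split=> [g0|[t ->]].
  have := mor_pull g (cl c); rewrite g0 => /mor_cmor[h [/= _ dh]].
  by exists (h ∘ bp_inr _); rewrite compA dh -compA bp_rr compm1.
apply/esym; rewrite -[LHS]push1; apply/mor_eq/cmor_cl.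
exists (copair (c_inf c) t) => /=; rewrite copair_inl compm1; split=> //.
rewrite comp_copair (confl0 (c_conf c)).
by rewrite /copair comp0m add0r.
Qed.

Lemma push_eq0 X Y T (c : conflation Y X) (u : hom X T) :
  push u (cl c) = 0 <-> exists r : hom (c_mid c) T, r ∘ c_inf c = u.
Proof.
split=> [u0|[r <-]].
  have := mor_push u (cl c); rewrite u0 => /mor_cmor[h [/= hi _]].
  by exists (bp_prl _ ∘ h); rewrite -compA hi compA bp_ll comp1m.
rewrite -[RHS]pull1; apply/mor_eq/cmor_cl.
exists (bpair r (c_def c)) => /=; rewrite prr_pair comp1m; split=> //.
rewrite pair_comp (confl0 (c_conf c)).
by rewrite /bpair compm0 addr0.
Qed.

Lemma pull_rep_eq0 X Y T (z : Ext Y X) (g : hom T Y) :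
  pull g z = 0 <-> factors_through g (c_def (rep z)).
Proof. by rewrite -pull_eq0 repK. Qed.

Lemma push_inf_rep X Y (z : Ext Y X) : push (c_inf (rep z)) z = 0.
Proof.
have := push_eq0 (rep z) (c_inf (rep z)); rewrite repK => ->.
by exists (idm _); rewrite comp1m.
Qed.

Lemma pull_def_rep X Y (z : Ext Y X) : pull (c_def (rep z)) z = 0.
Proof. by apply/pull_rep_eq0; exists (idm _); rewrite compm1. Qed.

Lemma split_rep X Y (z : Ext Y X) :
  z = 0 <-> exists s, c_def (rep z) ∘ s = idm Y.
Proof.
by rewrite -[z in z = 0]pull1 pull_rep_eq0; split=> -[s sE]; exists s.
Qed.

(** Exactness of the long exact sequence of [y] at Ext(T, K): a morphism between middle terms
    induces one on cokernels. *)
Lemma push_inf_exact K Y T (y : Ext Y K) (z : Ext T K) :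
  push (c_inf (rep y)) z = 0 -> exists f : hom T Y, pull f y = z.
Proof.
rewrite -{1}[z]repK => /push_eq0[r rE].
have [|f fE] := confl_desc (t := c_def (rep y) ∘ r) (c_conf (rep z)).
  by rewrite -compA rE (confl0 (c_conf _)).
exists f; rewrite -[RHS]push1; apply/esym/mor_eq.
by exists r; rewrite compm1 fE.
Qed.

Lemma pull_def_exact X Y K (y : Ext X Y) (z : Ext X K) :
  pull (c_def (rep y)) z = 0 -> exists u : hom Y K, push u y = z.
Proof.
move=> /pull_rep_eq0[r rE].
have [|u uE] := confl_lift (t := r ∘ c_inf (rep y)) (c_conf (rep z)).
  by rewrite compA -rE (confl0 (c_conf _)).
exists u; rewrite -[RHS]pull1; apply/mor_eq.
by exists r; rewrite comp1m -rE uE.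
Qed.

Lemma deflation_conf X Y (d : hom X Y) : deflation d ->
  exists K (x : Ext Y K), forall T (g : hom T Y), factors_through g d <-> pull g x = 0.
Proof.
move=> [K [i c]]; exists K, (cl (Conflation c)) => T g.
by have [h1 h2] := pull_eq0 (Conflation c) g; split.
Qed.

End Extensions.

(** * Direct sums and local objects *)

(** Case distinction on [ord0] for families of dependent type; the equality casts carry the two
    prescribed values to the type at [i]. *)
Lemma ord_choice n (T : 'I_n.+1 -> Type) (a0 : T ord0)
    (a : forall j, T (lift ord0 j)) :
  exists f : forall i, T i, f ord0 = a0 /\ forall j, f (lift ord0 j) = a j.
Proof.
have h i : {x : T i | (forall e : ord0 = i, x = ecast i (T i) e a0) /\
    forall j (e : lift ord0 j = i), x = ecast i (T i) e (a j)}.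
  case: (unliftP ord0 i) => [j ->|->].
    exists (a j); split=> [e|j' e]; first by case/eqP: (neq_lift ord0 j).
    by have ej := lift_inj e; case: _ / ej in e *; rewrite (eq_axiomK e).
  exists a0; split=> [e|j e]; first by rewrite (eq_axiomK e).
  by case/eqP: (neq_lift ord0 j).
exists (fun i => sval (h i)); split=> [|j].
  by have [/(_ erefl)] := svalP (h ord0).
by have [_ /(_ j erefl)] := svalP (h (lift ord0 j)).
Qed.

Section DirectSums.
Variables (k : comPzRingType).

Lemma direct_sum_ex (C : exactCat k) n (F : 'I_n -> C) :
  exists X : C, direct_sum_of X F.
Proof.
elim: n F => [|n IHn] F.
  have [Z Z0] := ex_zero (ex_axioms C); exists Z.
  have ab (T : 'I_0 -> Type) : forall i, T i by case.
  by exists (ab _), (ab _); split=> [[]|[]|]; rewrite ?big_ord0.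
have [X [inj [prj [pi1 pi0 ip]]]] := IHn (fun j => F (lift ord0 j)).
pose B := bp (F ord0) X.
have [inj' [inj0 injS]] := ord_choice (T := fun i => hom (F i) (bp_obj B))
  (bp_inl B) (fun j => bp_inr B ∘ inj j).
have [prj' [prj0 prjS]] := ord_choice (T := fun i => hom (bp_obj B) (F i))
  (bp_prl B) (fun j => prj j ∘ bp_prr B).
exists (bp_obj B), inj', prj'; split.
- move=> i; case: (unliftP ord0 i) => [j|] ->; last by rewrite inj0 prj0 bp_ll.
  by rewrite injS prjS -compA (compA (bp_prr B)) bp_rr comp1m pi1.
- move=> i j; case: (unliftP ord0 i) => [i'|] ->; case: (unliftP ord0 j) => [j'|] -> //.
  + rewrite injS prjS -compA (compA (bp_prr B)) bp_rr comp1m => nij.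
    by apply: pi0 => e; apply: nij; rewrite e.
  + by rewrite inj0 prjS -compA bp_rl compm0.
  + by rewrite injS prj0 compA bp_lr comp0m.
rewrite big_ord_recl inj0 prj0 -[RHS](bp_sum B); congr (_ + _).
transitivity (\sum_i bp_inr B ∘ (inj i ∘ prj i) ∘ bp_prr B).
  by apply: eq_bigr => i _; rewrite injS prjS !compA.
rewrite -(linear_sum (mklin (comp_linl (bp_prr B)))) /=.
by rewrite -(linear_sum (mklin (comp_linr (bp_inr B)))) /= ip compm1.
Qed.

Variable C : kcat k.
Implicit Types X Y : C.

Lemma comp_suml X Y Z n (g : 'I_n -> hom Y Z) (f : hom X Y) :
  (\sum_i g i) ∘ f = \sum_i g i ∘ f.
Proof. exact: (linear_sum (mklin (comp_linl f))). Qed.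
Lemma comp_sumr X Y Z n (g : hom Y Z) (f : 'I_n -> hom X Y) :
  g ∘ (\sum_i f i) = \sum_i g ∘ f i.
Proof. exact: (linear_sum (mklin (comp_linr g))). Qed.

Lemma is_iso_comp X Y Z (g : hom Y Z) (f : hom X Y) :
  is_iso g -> is_iso f -> is_iso (g ∘ f).
Proof.
move=> [g' [g1 g2]] [f' [f1 f2]]; exists (f' ∘ g'); split.
  by rewrite -compA (compA g') g1 comp1m.
by rewrite -compA (compA f) f2 comp1m.
Qed.

Lemma local_sum X n (f : 'I_n -> hom X X) :
  local_End X -> is_iso (\sum_i f i) -> exists i, is_iso (f i).
Proof.
move=> [id0 loc] iso; apply: contrapT => nex; move: iso.
suff : ~ is_iso (\sum_i f i) by [].
elim/big_ind: _ => // [|i _ fi]; last by apply: nex; exists i.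
by move=> [g [_]]; rewrite comp0m => /esym.
Qed.

Lemma local_idempotent X (e : hom X X) :
  local_End X -> e ∘ e = e -> e <> 0 -> e = idm X.
Proof.
move=> [_ loc] ee e0.
have cancel f : is_iso f -> f ∘ f = f -> f = idm X.
  by move=> [g [g1 _]] ff; rewrite -g1 -[in RHS]ff compA g1 comp1m.
apply: contrapT => ne; apply: (loc e (idm X - e)); last first.
- by rewrite addrC subrK; exists (idm X); rewrite comp1m.
- move=> /cancel h; apply: e0; apply: oppr_inj; rewrite oppr0.
  apply: (addrI (idm X)); rewrite addr0; apply: h.
  by rewrite compDl comp1m compNl compDr compm1 compNr ee subrr oppr0 addr0.
- by move=> /cancel/(_ ee).
Qed.

(** Up to the automorphism [r ∘ s], the map [s] is a split monomorphism; the resulting idempotent of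
    [Y] is nonzero, hence the identity. *)
Lemma local_split X Y (s : hom X Y) (r : hom Y X) :
  local_End Y -> idm X <> 0 -> is_iso (r ∘ s) -> is_iso s.
Proof.
move=> locY id0 [g [g1 _]].
have gr : g ∘ r ∘ s = idm X by rewrite -compA.
exists (g ∘ r); split=> //; apply: local_idempotent => //.
  by rewrite compA -(compA s) gr compm1.
move=> e; apply: id0.
by rewrite -[LHS]comp1m -{1}gr -gr compA -(compA (g ∘ r)) e compm0 comp0m.
Qed.

Lemma local_mul_iso X (f e : hom X X) :
  local_End X -> is_iso (f ∘ e) -> is_iso f.
Proof.
move=> locX iso; have [e' [e1 e2]] := local_split locX locX.1 iso.
rewrite -[f]compm1 -e2 compA; apply: is_iso_comp => //.
by exists e.
Qed.

End DirectSums.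

(** * Morphisms of the stable categories *)

Section StableMorphisms.
Variables (k : comPzRingType) (C : exactCat k).
Implicit Types X Y Z : C.

Lemma icls_surj X Y (a : @hom k (costab C) X Y) : exists u : hom X Y, a = icls u.
Proof. by exists (repr a); rewrite /icls qclsK. Qed.
Lemma pcls_surj X Y (a : @hom k (stab C) X Y) : exists f : hom X Y, a = pcls f.
Proof. by exists (repr a); rewrite /pcls qclsK. Qed.

Lemma icls_eq X Y (u v : hom X Y) : icls u = icls v <-> inj_trivial (u - v).
Proof. exact: (qpiP (ideal_submodule (inj_ideal C) X Y)). Qed.
Lemma pcls_eq X Y (f g : hom X Y) : pcls f = pcls g <-> proj_trivial (f - g).
Proof. exact: (qpiP (ideal_submodule (proj_ideal C) X Y)). Qed.

Lemma iclsM X Y Z (v : hom Y Z) (u : hom X Y) :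
  icls (v ∘ u) = icls v ∘ icls u :> @hom k (costab C) X Z.
Proof. exact: qclsM. Qed.
Lemma pclsM X Y Z (g : hom Y Z) (f : hom X Y) :
  pcls (g ∘ f) = pcls g ∘ pcls f :> @hom k (stab C) X Z.
Proof. exact: qclsM. Qed.

Lemma push_icls X Y Z (u v : hom X Y) (z : Ext Z X) :
  icls u = icls v -> push u z = push v z.
Proof.
move=> /icls_eq/(_ _ z) /eqP.
by rewrite pushDl -scaleN1r pushZl scaleN1r subr_eq0 => /eqP.
Qed.

Lemma icls_iso X Y (u : hom X Y) : is_iso u -> @is_iso k (costab C) X Y (icls u).
Proof. by move=> [v [vu uv]]; exists (icls v); rewrite -!iclsM vu uv. Qed.
End StableMorphisms.

(** * Auslander-Reiten pairs *)

(* eta exhibits K as tau X: by [ar_push_repr] and [ar_pull_repr] below it     *)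
(* induces costab Y K ~ D Ext(X, Y) and stab X Z ~ D Ext(Z, K).               *)
Record AR_pair (k : comPzRingType) (E : lmodType k) (C : exactCat k) (X K : C)
    (eta : {linear Ext X K -> E}) : Prop := ARPair {
  ar_push_nondeg : forall (Y : C) (z : Ext X Y), z <> 0 ->
    exists u : hom Y K, eta (push u z) <> 0;
  ar_push_triv : forall (Y : C) (u : hom Y K),
    (forall z : Ext X Y, eta (push u z) = 0) -> inj_trivial u;
  ar_pull_nondeg : forall (Z : C) (z : Ext Z K), z <> 0 ->
    exists g : hom X Z, eta (pull g z) <> 0;
  ar_pull_triv : forall (Z : C) (g : hom X Z),
    (forall z : Ext Z K, eta (pull g z) = 0) -> proj_trivial g }.

Definition has_AR_pairs (k : comPzRingType) (E : lmodType k) (C : exactCat k) : Prop :=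
  (forall X : C, exists (K : C) (eta : {linear Ext X K -> E}), AR_pair eta) /\
  (forall K : C, exists (X : C) (eta : {linear Ext X K -> E}), AR_pair eta).

Section ARPairs.
Variables (k : comPzRingType) (E : lmodType k) (C : exactCat k).
Hypotheses (k_art : artinian k) (E_min : minimal_injective_cogenerator E).
Hypothesis C_fin : hom_finite C.
Implicit Types X Y Z K T : C.

Lemma push_repr X K (eta : {linear Ext X K -> E}) Y :
  (forall z : Ext X Y, z <> 0 -> exists u : hom Y K, eta (push u z) <> 0) ->
  forall theta : {linear Ext X Y -> E},
    exists u : hom Y K, forall z, theta z = eta (push u z).
Proof.
move=> nondeg theta.
apply: (perfect_pairing k_art E_min (B := fun u z => eta (push u z))) => //.
- by move=> z a u u'; rewrite push_lin linearP.
- by move=> u a z z'; rewrite !linearP.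
Qed.

Lemma ar_push_repr X K (eta : {linear Ext X K -> E}) Y
    (theta : {linear Ext X Y -> E}) : AR_pair eta ->
  exists u : hom Y K, forall z, theta z = eta (push u z).
Proof. by move=> ar; apply: push_repr; apply: ar_push_nondeg ar Y. Qed.

Lemma ar_pull_repr X K (eta : {linear Ext X K -> E}) Z
    (theta : {linear Ext Z K -> E}) : AR_pair eta ->
  exists g : hom X Z, forall z, theta z = eta (pull g z).
Proof.
move=> ar.
apply: (perfect_pairing k_art E_min (B := fun g z => eta (pull g z))) => //.
- by move=> z a u u'; rewrite pull_lin linearP.
- by move=> u a z z'; rewrite !linearP.
- exact: ar_pull_nondeg ar Z.
Qed.

(** The conditions on pushouts imply those on pullbacks. If [eta] kills all pullbacks of [z], it
    kills the kernel of pushing along the inflation [a] of [z], so it factors through that push;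
    representing the factor by [u] shows that [u ∘ a] acts as the identity on Ext(-, K), while [a]
    kills [z]. *)
Lemma AR_pair_intro X K (eta : {linear Ext X K -> E}) :
  (forall Y (z : Ext X Y), z <> 0 -> exists u : hom Y K, eta (push u z) <> 0) ->
  (forall Y (u : hom Y K), (forall z : Ext X Y, eta (push u z) = 0) -> inj_trivial u) ->
  AR_pair eta.
Proof.
move=> nondeg triv; split=> // [Z z z0|Z g g0 Y y].
- apply: contrapT => nex; apply: z0; set a := c_inf (rep z).
  have [w|theta thE] := @linear_extension k E E_min _ _
      (push a : {linear Ext X K -> _}) eta.
    move=> /push_inf_exact[f <-].
    by apply: contrapT => f0; apply: nex; exists f.
  have [u uE] := push_repr (nondeg _) theta.
  have /triv/(_ _ z) : forall w : Ext X K, eta (push (idm K - u ∘ a) w) = 0.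
    move=> w; rewrite pushDl -scaleN1r pushZl scaleN1r linearB push1.
    by rewrite -push_push -uE thE subrr.
  rewrite pushDl -scaleN1r pushZl scaleN1r push1 => /eqP.
  rewrite subr_eq0 -push_push => /eqP ->.
  by rewrite push_inf_rep linear0.
- apply: contrapT => /nondeg[u]; apply.
  by rewrite -pull_push g0.
Qed.

Lemma ar_direct_sum n (F G : 'I_n -> C) X K :
  direct_sum_of X F -> direct_sum_of K G ->
  (forall i, exists eta : {linear Ext (F i) (G i) -> E}, AR_pair eta) ->
  exists eta : {linear Ext X K -> E}, AR_pair eta.
Proof.
move=> [inX [prX [pX1 pX0 sX]]] [inK [prK [pK1 pK0 sK]]] ar_i.
pose eta i := projT1 (cid (ar_i i)); have ar i : AR_pair (eta i) := projT2 (cid (ar_i i)).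
pose f (z : Ext X K) := \sum_i eta i (push (prK i) (pull (inX i) z)).
have fL : linear f.
  move=> a z z'; rewrite scaler_sumr -big_split /=; apply: eq_bigr => i _.
  by rewrite !linearP.
have fS i Y (u : hom Y (G i)) (z : Ext X Y) :
    f (push (inK i ∘ u) z) = eta i (push u (pull (inX i) z)).
  rewrite /f (bigD1 i) //= big1 ?addr0 => [|j /eqP ji].
    by rewrite pull_push push_push compA pK1 comp1m.
  by rewrite pull_push push_push compA pK0 // comp0m push0; apply: linear0.
exists (mklin fL); apply: AR_pair_intro => [Y z z0|Y u uf].
  have [i zi] : exists i, pull (inX i) z <> 0.
    apply: contrapT => nex; apply: z0.
    rewrite -[z]pull1 -sX pull_suml big1 // => i _.
    rewrite -pull_pull (_ : pull (inX i) z = 0) ?pull0r //.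
    by apply: contrapT => zi; apply: nex; exists i.
  have [u uz] := ar_push_nondeg (ar i) zi.
  by exists (inK i ∘ u); rewrite /= fS.
have ui i : inj_trivial (prK i ∘ u).
  apply: (ar_push_triv (ar i)) => z.
  have := uf (pull (prX i) z); rewrite /= /f (bigD1 i) //= big1 ?addr0 => [|j /eqP ji].
    by rewrite pull_push push_push pull_pull pX1 pull1.
  rewrite pull_push push_push pull_pull pX0 //; last by move=> ij; apply: ji.
  by rewrite pull0l !linear0.
move=> Z z; rewrite -[u]comp1m -sK comp_suml push_suml big1 // => i _.
by rewrite -compA -push_push ui push0r.
Qed.

Lemma ar_zero X K : (forall Y (z : Ext X Y), z = 0) -> (forall Z (z : Ext Z K), z = 0) ->
  exists eta : {linear Ext X K -> E}, AR_pair eta.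
Proof.
move=> X0 K0; have zL : linear (fun=> 0 : E) by move=> U a x y; rewrite scaler0 addr0.
exists (mklin (zL _)); apply: AR_pair_intro => [Y z|Y u _ Z z]; first by rewrite (X0 _ z).
exact: K0.
Qed.

Lemma ar_iso X K K' (eta : {linear Ext X K -> E}) (s : hom K' K) :
  @is_iso k (costab C) K' K (icls s) -> AR_pair eta ->
  exists eta' : {linear Ext X K' -> E}, AR_pair eta'.
Proof.
move=> [r']; have [r ->] := icls_surj r'; move=> [rs sr] ar.
have rsE Z z : push (r ∘ s) z = z :> Ext Z K'.
  by rewrite -[RHS]push1; apply: push_icls; apply: etrans (iclsM r s) rs.
have srE Z z : push (s ∘ r) z = z :> Ext Z K.
  by rewrite -[RHS]push1; apply: push_icls; apply: etrans (iclsM s r) sr.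
exists (eta \o push s : {linear _ -> _}); apply: AR_pair_intro => [Y z|Y u uf Z z].
  move=> /(ar_push_nondeg ar)[u uz]; exists (r ∘ u).
  by rewrite /= -push_push push_push srE.
have su : inj_trivial (s ∘ u).
  by apply: (ar_push_triv ar) => w; rewrite -push_push; apply: uf.
rewrite -[LHS]rsE -push_push (push_push u s) su.
exact: push0r.
Qed.

(** [idm K - e] kills [xi], so it is not invertible, and locality makes [e] invertible. *)
Lemma fixed_iso X K (xi : Ext X K) (e : hom K K) :
  local_End K -> xi <> 0 -> push e xi = xi -> is_iso e.
Proof.
move=> [_ loc] xi0 exi; apply: contrapT => ne.
apply: (loc e (idm K - e)) => //; last by rewrite addrC subrK; apply: is_iso_idm.
move=> [g [g1 _]]; apply: xi0; rewrite -[LHS]push1 -g1 -push_push.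
by rewrite pushDl -scaleN1r pushZl scaleN1r push1 exi subrr push0r.
Qed.

(** An almost split [xi] is a pushout of every nonzero extension of X, because the deflation of such
    an extension is not split. Hence any functional that does not vanish at [xi] works. *)
Lemma almost_split_pair X K (xi : Ext X K) : local_End K -> xi <> 0 ->
  (forall T (g : hom T X), (forall h, g ∘ h <> idm X) -> pull g xi = 0) ->
  exists eta : {linear Ext X K -> E}, AR_pair eta.
Proof.
move=> locK xi0 rsplit; have [eta eta_xi] := E_min.1.2 _ _ xi0.
have to_xi Y (z : Ext X Y) : z <> 0 -> exists u : hom Y K, push u z = xi.
  move=> z0; apply/pull_def_exact/rsplit => h hE.
  by apply/z0/split_rep; exists h.
exists eta; apply: AR_pair_intro => [Y z /to_xi[u uE]|Y u uf Z z].
  by exists u; rewrite uE.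
apply: contrapT; set w := push u z => w0.
(* If the inflation of [w] did not kill [xi], pushing further would return to [xi]; by [fixed_iso]
   the inflation would then be a split monomorphism and [w] zero. *)
have [|g gE] := @push_inf_exact _ _ _ _ _ w xi.
  apply: contrapT => /to_xi[v]; rewrite push_push => /(fixed_iso locK xi0)[r [r1 _]].
  by apply: w0; rewrite -[w]push1 -r1 -!push_push push_inf_rep !push0r.
by apply: eta_xi; rewrite -gE pull_push uf.
Qed.

Lemma push_inj_sum X K n (G : 'I_n -> C) (xi : Ext X K) :
  direct_sum_of K G -> xi <> 0 -> exists i (p : hom K (G i)), push p xi <> 0.
Proof.
move=> [inj [prj [_ _ s]]] xi0; apply: contrapT => nex; apply: xi0.
rewrite -[xi]push1 -s push_suml big1 // => i _.
rewrite -push_push (_ : push (prj i) xi = 0) ?push0r //.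
by apply: contrapT => h; apply: nex; exists i, (prj i).
Qed.

Lemma zero_object_ext X K : idm K = 0 -> forall z : Ext X K, z = 0.
Proof. by move=> K0 z; rewrite -[z]push1 K0 push0. Qed.

Lemma zero_object_ext_l X K : idm X = 0 -> forall z : Ext X K, z = 0.
Proof. by move=> X0 z; rewrite -[z]pull1 X0 pull0l. Qed.

(** * Determined deflations and Auslander-Reiten pairs *)

Hypothesis C_KS : krull_schmidt C.

Section FromDetermined.
Hypothesis det : right_stably_determined_deflations C.

(** The last disjunct covers projective X, where K is a zero object. Otherwise the deflation
    determined by X with image rad End(X) gives an extension killed by every [g] that is not a split
    epimorphism, and a nonzero component of it in an indecomposable summand of its kernel is almost
    split. *)
Lemma ar_local X : local_End X -> exists K (eta : {linear Ext X K -> E}),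
  AR_pair eta /\ (local_End K \/ idm K = 0).
Proof.
move=> locX; have [id0 addX] := locX.
have [X0|nX0] := EM (proj_trivial (idm X)).
  have [Z Z0] := ex_zero (ex_axioms C).
  have [|z|eta ar] := @ar_zero X Z _.
  - by move=> Y z; rewrite -[z]pull1; apply: X0.
  - exact: zero_object_ext.
  by exists Z, eta; split=> //; right.
(* The non-isomorphisms form rad End(X); they include the projectively trivial endomorphisms because
   X is not projective. *)
have [|f f0 [g [_ fg]]|Y0 [alpha [def detX imX]]] :=
    (det X).2 X (fun f => ~ is_iso f).
- split=> // [[g [_]]|f e nf]; first by rewrite comp0m => /esym.
  by move=> /(local_mul_iso locX).
- by apply: nX0 => Z z; rewrite -fg -pull_pull f0 pull0r.
have [K' [xi' xiE]] := deflation_conf def.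
have xi'0 : xi' <> 0.
  move=> xi'0; have /xiE[s sE] : pull (idm X) xi' = 0 by rewrite pull1.
  have /(imX (idm X)) : exists s, alpha ∘ s = idm X by exists s.
  by apply; apply: is_iso_idm.
have [n [G [sG locG]]] := C_KS K'.
have [i [p p0]] := push_inj_sum sG xi'0.
have [|eta ar] := almost_split_pair (locG i) p0.
  move=> T g gn; rewrite pull_push (_ : pull g xi' = 0) ?push0r //.
  apply/xiE/detX => h; suff /imX[s <-] : ~ is_iso (g ∘ h) by exists s.
  by move=> [r [_ ghr]]; apply: (gn (h ∘ r)); rewrite compA.
by exists (G i), eta; split=> //; left.
Qed.

(* A nonzero extension of Y by K is determined by some D; pushing it along    *)
(* generators of Hom(K, tau D) loses nothing, so K is a summand of a power of *)
(* tau D, hence isomorphic to tau of an indecomposable summand of D.          *)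
Lemma ar_local_sub K : local_End K -> exists X (eta : {linear Ext X K -> E}), AR_pair eta.
Proof.
move=> locK; have [idK0 _] := locK.
have [K0|/existsNP[Y /existsNP[xi xi0]]] := EM (forall Z (z : Ext Z K), z = 0).
  have [Z Z0] := ex_zero (ex_axioms C).
  by exists Z; apply: ar_zero => //; move=> Y z; apply: zero_object_ext_l.
have [|D detD] := (det Y).1 _ (c_def (rep xi)).
  by exists K, (c_inf (rep xi)); apply: c_conf.
have [n [F [sF locF]]] := C_KS D.
have /choice[G arG] : forall i, exists L : C, exists eta : {linear Ext (F i) L -> E},
    AR_pair eta /\ (local_End L \/ idm L = 0).
  by move=> i; apply: ar_local.
have [L sL] := direct_sum_ex G.
have [|eta ar] := ar_direct_sum sF sL.
  by move=> i; have [eta []] := arG i; exists eta.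
have [m [v vgen]] := C_fin K L.
have [B [inB [prB [pB1 pB0 sB]]]] := direct_sum_ex (fun _ : 'I_m => L).
pose u := \sum_j inB j ∘ v j.
have prBu j : prB j ∘ u = v j.
  rewrite comp_sumr (bigD1 j) //= big1 ?addr0 => [|i /eqP ij].
    by rewrite compA pB1 comp1m.
  by rewrite compA pB0 ?comp0m // => ji; apply: ij.
have u_mono T (z : Ext T K) : push u z = 0 -> forall w : hom K L, push w z = 0.
  move=> uz w; have [a ->] := vgen w; rewrite push_suml big1 // => j _.
  by rewrite pushZl -prBu -push_push uz push0r scaler0.
(* To split [u] off on [xi], the deflation of [push u xi] must kill [xi]. Determination reduces this
   to Ext(D, K), where the pair of [D] and [L] detects nonzero elements by maps to [L], and all of
   these factor through [u]. *)
have [|w wE] := @pull_def_exact _ _ _ _ _ (push u xi) xi.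
  apply/pull_rep_eq0/detD => h; apply/pull_rep_eq0.
  apply: contrapT => /(ar_push_nondeg ar)[w]; apply.
  by rewrite u_mono ?linear0 // -pull_push -pull_pull pull_def_rep pull0r.
have wu : is_iso (w ∘ u).
  by apply: (fixed_iso locK xi0); rewrite -push_push.
have [inL [prL [_ _ sL1]]] := sL.
move: wu; rewrite -[w]compm1 -sB comp_sumr comp_suml => /(local_sum locK)[j].
rewrite -[inB j]compm1 -sL1 !(comp_sumr, comp_suml) => /(local_sum locK)[i].
have -> : w ∘ (inB j ∘ (inL i ∘ prL i) ∘ prB j) ∘ u =
    (w ∘ inB j ∘ inL i) ∘ (prL i ∘ prB j ∘ u) by rewrite !compA.
have [eta' [ar' [locG|G0]]] := arG i => iso.
  by exists (F i); apply: ar_iso ar'; apply/icls_iso/(local_split locG idK0 iso).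
by have [g [+ _]] := iso; rewrite -[prL i]comp1m G0 !comp0m !compm0 => /esym.
Qed.

Lemma determined_AR_pairs : has_AR_pairs E C.
Proof.
split=> [X|K].
  have [n [F [sF locF]]] := C_KS X.
  have /choice[G arG] : forall i, exists L : C, exists eta : {linear Ext (F i) L -> E},
      AR_pair eta.
    by move=> i; have [L [eta []]] := ar_local (locF i); exists L, eta.
  by have [L sL] := direct_sum_ex G; exists L; apply: ar_direct_sum sF sL arG.
have [n [G [sG locG]]] := C_KS K.
have /choice[F arF] : forall i, exists X : C, exists eta : {linear Ext X (G i) -> E},
    AR_pair eta.
  by move=> i; apply: ar_local_sub.
by have [X sX] := direct_sum_ex F; exists X; apply: ar_direct_sum sX sG arF.
Qed.

End FromDetermined.

(** A deflation with kernel K is determined by the partner of K. For prescribed H, the generators of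
    its orthogonal [U] in Ext(Y, K) combine into one extension by a power of K; [double_perp]
    recovers H as the morphisms killing it. *)
Lemma AR_pairs_determined : has_AR_pairs E C -> right_stably_determined_deflations C.
Proof.
move=> [arX arK] Y; split=> [X f /deflation_conf[K [xi xiE]]|D H [H0 HD HG] HP].
  have [D [eta ar]] := arK K; exists D => T g gh; apply/xiE.
  apply: contrapT => /(ar_pull_nondeg ar)[h]; apply.
  by rewrite pull_pull (_ : pull _ xi = 0) ?linear0 //; apply/xiE/gh.
have [K [eta ar]] := arX D.
have HZ a f : H f -> H (a *: f).
  by move=> Hf; rewrite -[f]compm1 -compZr; apply: HG.
pose HS := @Submodule k (hom D Y) H H0 HD HZ.
pose B (h : hom D Y) (x : Ext Y K) := eta (pull h x).
have Bl x : linear (B^~ x) by move=> a h h'; rewrite /B pull_lin linearP.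
have Br h : linear (B h) by move=> a x x'; rewrite /B !linearP.
have U0 : forall h, H h -> B h 0 = 0 by move=> h _; rewrite /B !linear0.
have UD x y : (forall h, H h -> B h x = 0) -> (forall h, H h -> B h y = 0) ->
    forall h, H h -> B h (x + y) = 0.
  by move=> hx hy h Hh; rewrite /B !linearD [eta _]hx // [eta _]hy // addr0.
have UZ a x : (forall h, H h -> B h x = 0) -> forall h, H h -> B h (a *: x) = 0.
  by move=> hx h Hh; rewrite /B !linearZ_LR [eta _]hx // scaler0.
pose U := @Submodule k (Ext Y K) (fun x => forall h, H h -> B h x = 0) U0 UD UZ.
have [n [xi [Uxi gen]]] := submodule_fin_gen k_art E_min (C_fin D Y) Bl Br
  (ar_pull_nondeg ar (Z := Y)) U.
have [L [inL [prL [pL1 pL0 sL]]]] := direct_sum_ex (fun _ : 'I_n => K).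
pose x := \sum_i push (inL i) (xi i).
have prx i : push (prL i) x = xi i.
  rewrite linear_sum (bigD1 i) //= big1 ?addr0 => [|j /eqP ji].
    by rewrite push_push pL1 push1.
  by rewrite push_push pL0 ?push0 // => ij; apply: ji.
have pull_x T (g : hom T Y) : pull g x = 0 <-> forall i, pull g (xi i) = 0.
  split=> [gx i|gxi]; first by rewrite -prx pull_push gx push0r.
  by rewrite linear_sum big1 // => i _; rewrite /= pull_push gxi push0r.
exists (c_mid (rep x)), (c_def (rep x)); split.
- by exists L, (c_inf (rep x)); apply: c_conf.
- move=> T g gh; apply/pull_rep_eq0/pull_x => i.
  apply: contrapT => /(ar_pull_nondeg ar)[h]; apply.
  have /pull_rep_eq0/pull_x/(_ i) := gh h.
  by rewrite pull_pull => ->; rewrite linear0.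
move=> g; have -> : (exists s, c_def (rep x) ∘ s = g) <-> pull g x = 0.
  by rewrite pull_rep_eq0; split=> -[s sE]; exists s.
rewrite pull_x; split=> [Hg i|gxi].
  apply: contrapT => /(ar_push_nondeg ar)[e].
  (* The test endomorphism [e] of K is traded for an endomorphism [c] of [D]; this is where
     stability of H under precomposition enters. *)
  have [c cE] := ar_pull_repr (eta \o push e : {linear _ -> _}) ar.
  by rewrite [eta _]cE pull_pull; apply; apply: Uxi; apply: HG.
have gU y : U y -> B g y = 0.
  move=> /gen[a ->]; rewrite /B linear_sum big1 ?linear0 // => i _.
  by rewrite linearZ_LR /= gxi scaler0.
have [h Hh hE] := double_perp k_art E_min (C_fin D Y) Bl Br (H := HS)
  (theta := mklin (Br g)) gU.
rewrite -[g](subrK h) addrC; apply: (HD) => //; apply/HP/(ar_pull_triv ar) => z.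
rewrite pullDl -scaleN1r pullZl scaleN1r linearB.
by have /= := hE z; rewrite /B => ->; rewrite subrr.
Qed.

End ARPairs.

(** * Equivalences from fully faithful dense functors *)

Lemma inj_surj_bijective (S T : Type) (f : S -> T) :
  injective f -> (forall y, exists x, f x = y) -> bijective f.
Proof.
move=> finj /choice[g gK]; exists g => // x.
by apply: finj; rewrite gK.
Qed.

Lemma moddual_ext (k : comPzRingType) (E M : lmodType k) (f g : moddual E M) :
  (forall x, f x = g x) -> f = g.
Proof. exact: linear_ext. Qed.

(** Besides the quasi-inverse, the chosen isomorphisms [i] are returned with their naturality, since
    they transport one duality isomorphism to the other. *)
Lemma dense_quasi_inverse (k : comPzRingType) (A B : kcat k) (F : functor A B) :
  (forall X Y, injective (@fmap k A B F X Y)) ->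
  (forall X Y (g : hom (F X) (F Y)), exists f, fmap F f = g) ->
  (forall Y, exists X (i : hom Y (F X)), is_iso i) ->
  exists (G : functor B A) (i : forall Y, hom Y (F (G Y))),
    [/\ quasi_inverse F G, forall Y, is_iso (i Y) &
        forall Y Y' (g : hom Y Y'), fmap F (fmap G g) ∘ i Y = i Y' ∘ g].
Proof.
move=> faith full dense.
have d Y : {X : A & {i : hom Y (F X) & {j : hom (F X) Y |
    j ∘ i = idm Y /\ i ∘ j = idm (F X)}}}.
  have [X /cid[i /cid[j ij]]] := cid (dense Y).
  by exists X, i, j.
pose GY Y := projT1 (d Y); pose i Y := projT1 (projT2 (d Y)).
pose j Y := sval (projT2 (projT2 (d Y))).
have ji Y : j Y ∘ i Y = idm Y by have [] := svalP (projT2 (projT2 (d Y))).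
have ij Y : i Y ∘ j Y = idm _ by have [] := svalP (projT2 (projT2 (d Y))).
pose Gmap Y Y' (g : hom Y Y') := projT1 (cid (full _ _ (i Y' ∘ g ∘ j Y))).
have GmapE Y Y' (g : hom Y Y') : fmap F (Gmap Y Y' g) = i Y' ∘ g ∘ j Y.
  by rewrite /Gmap; case: cid.
have G1 Y : Gmap Y Y (idm Y) = idm (GY Y).
  by apply: faith; rewrite GmapE fmap1 compm1 ij.
have GM Y Y' Y'' (g : hom Y' Y'') (f : hom Y Y') :
    Gmap Y Y'' (g ∘ f) = Gmap Y' Y'' g ∘ Gmap Y Y' f.
  by apply: faith; rewrite fmapM !GmapE !compA -(compA _ (j Y')) ji compm1.
pose G := Functor G1 GM; exists G, i; split.
- split.
    pose e X := projT1 (cid (full (GY (F X)) X (j (F X)))).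
    have eE X : fmap F (e X) = j (F X) by rewrite /e; case: cid.
    exists e; split=> [X|X Y f].
      have [e' e'E] := full _ _ (i (F X)).
      by exists e'; split; apply: faith; rewrite fmapM fmap1 e'E eE ?ij ?ji.
    by apply: faith; rewrite !fmapM !eE GmapE !compA ji comp1m.
  exists j; split=> [Y|X Y f]; first by exists (i Y); split; [apply: ij | apply: ji].
  by rewrite /= GmapE !compA ji comp1m.
- by move=> Y; exists (j Y); split; [apply: ji | apply: ij].
by move=> Y Y' g; rewrite /= GmapE -compA ji compm1.
Qed.

(** * Auslander-Reiten duality *)

Section Duality.
Variables (k : comPzRingType) (E : lmodType k) (C : exactCat k).
Hypotheses (k_art : artinian k) (E_min : minimal_injective_cogenerator E).
Hypothesis C_fin : hom_finite C.
Implicit Types X Y Z K T : C.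

(** Yoneda: [eta] is the image of the identity of tau X, and naturality turns [phi] into pairing
    with [eta]. Every K occurs because it is costably isomorphic to tau of its image under the
    quasi-inverse. *)
Lemma AR_duality_pairs : AR_duality C E -> has_AR_pairs E C.
Proof.
move=> [tau [taum [[_ [eps [eps_iso _]]] [[phi [phi_bij phi_nat]] _]]]].
have arX X : exists eta : {linear Ext X (tau X : C) -> E}, AR_pair eta.
  pose eta : {linear Ext X (tau X : C) -> E} := phi X (tau X) (idm (tau X)).
  have phiE Y (u : hom Y (tau X : C)) z : phi X Y (icls u) z = eta (push u z).
    rewrite /eta -[in RHS](pull1 z) -phi_nat -[pcls _]/(@idm k (stab C) X).
    by rewrite fmap1 !comp1m.
  exists eta; apply: AR_pair_intro => // Y => [z z0|u uz].
    have [th thz] := E_min.1.2 _ _ z0.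
    have [phi' _ phiK] := phi_bij X Y.
    have [u uE] := icls_surj (phi' (th : moddual E (Ext X Y))).
    by exists u; rewrite -phiE -uE phiK.
  have /icls_eq : icls u = icls 0; last by rewrite subr0.
  apply: (bij_inj (phi_bij X Y)); apply: (@moddual_ext k E (Ext X Y)) => z.
  by rewrite phiE phiE uz push0 linear0.
split=> [X|K]; first by have [eta ar] := arX X; exists (tau X), eta.
have [eta ar] := arX (taum K : C); exists (taum K : C).
have [v [vu uv]] := eps_iso K; have [s sE] := icls_surj v.
apply: (ar_iso k_art E_min C_fin _ ar (s := s)).
by exists (eps K); rewrite -sE.
Qed.

(** * The translate as a functor *)

Section Transpose.
Variables (tau : C -> C) (eta : forall X, {linear Ext X (tau X) -> E}).
Hypothesis ar : forall X, AR_pair (eta X).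
Hypothesis ar_dense : forall K, exists X (eta' : {linear Ext X K -> E}), AR_pair eta'.

(** Adjointness of [f] and [u] for the functionals. It is kept as a relation, since each side
    determines the other only modulo trivial morphisms ([transpose_eq]). *)
Definition transpose X X' (f : hom X X') (u : hom (tau X) (tau X')) : Prop :=
  forall z : Ext X' (tau X), eta X' (push u z) = eta X (pull f z).

Lemma transpose_ex X X' (f : hom X X') : exists u, transpose f u.
Proof.
have [u uE] := ar_push_repr k_art E_min C_fin
  (eta X \o pull f : {linear Ext X' (tau X) -> E}) (ar X').
by exists u => z; rewrite -uE.
Qed.

Lemma transpose_ex_inv X X' (u : hom (tau X) (tau X')) : exists f, transpose f u.
Proof.
have [f fE] := ar_pull_repr k_art E_min C_fin
  (eta X' \o push u : {linear Ext X' (tau X) -> E}) (ar X).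
by exists f => z; rewrite -fE.
Qed.

Lemma transpose_lin X X' a (f f' : hom X X') u u' :
  transpose f u -> transpose f' u' -> transpose (a *: f + f') (a *: u + u').
Proof.
move=> fu fu' z; rewrite pushDl pushZl pullDl pullZl.
by rewrite !linearP fu fu'.
Qed.

Lemma transpose_comp X X' X'' (f : hom X X') (g : hom X' X'') u v :
  transpose f u -> transpose g v -> transpose (g ∘ f) (v ∘ u).
Proof. by move=> fu gv z; rewrite -push_push gv pull_push fu pull_pull. Qed.

Lemma transpose_id X : transpose (idm X) (idm (tau X)).
Proof. by move=> z; rewrite push1 pull1. Qed.

Lemma transpose_eq X X' (f f' : hom X X') u u' :
  transpose f u -> transpose f' u' -> pcls f = pcls f' <-> icls u = icls u'.
Proof.
move=> fu fu'; have := transpose_lin (-1) fu' fu.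
rewrite !scaleN1r !(addrC (- _)) => d.
rewrite pcls_eq icls_eq; split=> triv.
  by apply: (ar_push_triv (ar X')) => z; rewrite d triv linear0.
by apply: (ar_pull_triv (ar X)) => z; rewrite -d triv linear0.
Qed.

Lemma tmap_ex X X' (f : @hom k (stab C) X X') :
  exists a : @hom k (costab C) (tau X) (tau X'),
    exists f0 u, [/\ f = pcls f0, a = icls u & transpose f0 u].
Proof.
have [f0 ->] := pcls_surj f; have [u fu] := transpose_ex f0.
by exists (icls u), f0, u.
Qed.

Definition tmap X X' (f : @hom k (stab C) X X') := projT1 (cid (tmap_ex f)).

Lemma tmapE X X' (f : hom X X') u : transpose f u -> tmap (pcls f) = icls u.
Proof.
move=> fu; rewrite /tmap; case: cid => a [f' [u' [ff' aE fu']]] /=.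
by rewrite aE; apply/(transpose_eq fu' fu); rewrite -ff'.
Qed.

Lemma tmap1 X : tmap (@idm k (stab C) X) = @idm k (costab C) (tau X).
Proof. exact: tmapE (@transpose_id X). Qed.

Lemma tmapM X Y Z (g : @hom k (stab C) Y Z) (f : @hom k (stab C) X Y) :
  tmap (g ∘ f) = tmap g ∘ tmap f.
Proof.
have [[f0 ->] [g0 ->]] := (pcls_surj f, pcls_surj g).
have [[u fu] [v gv]] := (transpose_ex f0, transpose_ex g0).
by rewrite -pclsM (tmapE fu) (tmapE gv) (tmapE (transpose_comp fu gv)) iclsM.
Qed.

Definition tfun : functor (stab C) (costab C) :=
  @Functor k (stab C) (costab C) tau tmap tmap1 tmapM.

Lemma tmap_linear X X' : linear (@tmap X X').
Proof.
move=> a f f'; have [[f0 ->] [f0' ->]] := (pcls_surj f, pcls_surj f').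
have [[u fu] [u' fu']] := (transpose_ex f0, transpose_ex f0').
rewrite (tmapE fu) (tmapE fu') /pcls /icls -!qcls_linear.
exact: tmapE (transpose_lin a fu fu').
Qed.

Lemma tmap_inj X X' : injective (@tmap X X').
Proof.
move=> f f'; have [[f0 ->] [f0' ->]] := (pcls_surj f, pcls_surj f').
have [[u fu] [u' fu']] := (transpose_ex f0, transpose_ex f0').
by rewrite (tmapE fu) (tmapE fu') => /(transpose_eq fu fu').
Qed.

Lemma tmap_full X X' (a : @hom k (costab C) (tau X) (tau X')) :
  exists f, tmap f = a.
Proof.
have [u ->] := icls_surj a; have [f fu] := transpose_ex_inv u.
by exists (pcls f); apply: tmapE.
Qed.

(** Two objects paired with the same X both represent the dual of Ext(X, -) on the costable
    category, hence are isomorphic there. *)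
Lemma tau_dense K : exists X (i : @hom k (costab C) K (tau X)), is_iso i.
Proof.
have [X [eta' ar']] := ar_dense K; exists X.
have [u uE] := ar_push_repr k_art E_min C_fin eta' (ar X).
have [v vE] := ar_push_repr k_art E_min C_fin (eta X) ar'.
have sub T Y (w : hom T Y) (w' : hom T Y) Z (z : Ext Z T) :
    push (w - w') z = push w z - push w' z.
  by rewrite pushDl -scaleN1r pushZl scaleN1r.
exists (icls u), (icls v); split; rewrite -iclsM; apply/icls_eq.
  by apply: (ar_push_triv ar') => z; rewrite sub linearB -push_push -vE -uE push1 subrr.
by apply: (ar_push_triv (ar X)) => z; rewrite sub linearB -push_push -uE -vE push1 subrr.
Qed.

Lemma phi_ex X Y (a : @hom k (costab C) Y (tau X)) :
  exists th : moddual E (Ext X Y),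
    exists2 u, a = icls u & forall z, th z = eta X (push u z).
Proof.
have [u ->] := icls_surj a.
by exists (eta X \o push u : {linear _ -> _}), u.
Qed.

Definition phi0 X Y (a : @hom k (costab C) Y (tau X)) := projT1 (cid (phi_ex a)).

Lemma phi0E X Y (u : hom Y (tau X)) z : phi0 (icls u) z = eta X (push u z).
Proof.
rewrite /phi0; case: cid => th [u' uu' thE] /=; rewrite thE.
by rewrite (push_icls z uu').
Qed.

Lemma phi0_linear X Y : linear (@phi0 X Y).
Proof.
move=> c a a'; have [[u ->] [u' ->]] := (icls_surj a, icls_surj a').
apply: moddual_ext => z; rewrite -(qcls_linear (inj_ideal C) c u u').
by rewrite [LHS]phi0E pushDl pushZl linearP /= !phi0E.
Qed.

Lemma phi0_bij X Y : bijective (@phi0 X Y).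
Proof.
apply: inj_surj_bijective => [a a'|th]; last first.
  have [u uE] := ar_push_repr k_art E_min C_fin th (ar X).
  by exists (icls u); apply: moddual_ext => z; rewrite phi0E uE.
have [[u ->] [u' ->]] := (icls_surj a, icls_surj a') => e.
apply/icls_eq/(ar_push_triv (ar X)) => z.
by rewrite pushDl -scaleN1r pushZl scaleN1r linearB -!phi0E e subrr.
Qed.

Lemma phi0_nat X X' Y Y' (f : hom X X') (v : hom Y' Y)
    (a : @hom k (costab C) Y (tau X)) (x : Ext X' Y') :
  phi0 (tmap (pcls f) ∘ a ∘ icls v) x = phi0 a (push v (pull f x)).
Proof.
have [u ->] := icls_surj a; have [w fw] := transpose_ex f.
rewrite (tmapE fw) -!iclsM !phi0E -!push_push fw.
by rewrite pull_push push_push pull_push push_push.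
Qed.

Lemma transpose_duality : AR_duality C E.
Proof.
have [taum [i [qi i_iso i_nat]]] :=
  dense_quasi_inverse (F := tfun) tmap_inj tmap_full tau_dense.
exists tfun, taum; split=> //; split.
  exists (fun X Y => mklin (@phi0_linear X Y)).
  by split=> [X Y|X X' Y Y' f v a x]; [apply: phi0_bij | apply: phi0_nat].
(* The second isomorphism is [phi0] preceded by the hom bijection of the equivalence, with unit
   [i]. *)
pose psi X Y (b : @hom k (stab C) (taum Y) X) : moddual E (Ext X Y) :=
  phi0 (fmap tfun b ∘ i Y).
have psiL X Y : linear (psi X Y).
  move=> a b b'; rewrite /psi.
  have -> : fmap tfun (a *: b + b') = a *: fmap tfun b + fmap tfun b'.
    exact: tmap_linear.
  by rewrite compDl compZl phi0_linear.
exists (fun X Y => mklin (psiL X Y)); split=> [X Y|X X' Y Y' f v b x].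
  have [j [ji ij]] := i_iso Y; apply: inj_surj_bijective => [b b'|th].
    move=> /(bij_inj (phi0_bij _ _)) e; apply: tmap_inj.
    by rewrite -[LHS]compm1 -[RHS]compm1 -ij !compA [_ ∘ i Y]e.
  have [phi' _ phiK] := phi0_bij X Y.
  have [b bE] := tmap_full (phi' th ∘ j).
  have e : fmap tfun b ∘ i Y = phi' th.
    by rewrite [fmap tfun b]bE -compA ji compm1.
  by exists b; rewrite -[RHS]phiK -e.
have e : fmap tfun (pcls f ∘ b ∘ fmap taum (icls v)) ∘ i Y' =
    fmap tfun (pcls f) ∘ (fmap tfun b ∘ i Y) ∘ icls v.
  by rewrite !fmapM -!compA i_nat.
by rewrite -phi0_nat; congr (phi0 _ x).
Qed.

End Transpose.

Lemma AR_pairs_duality : has_AR_pairs E C -> AR_duality C E.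
Proof.
move=> [arX arK].
pose tau X := projT1 (cid (arX X)); pose eta X := projT1 (cid (projT2 (cid (arX X)))).
exact: (@transpose_duality tau eta (fun X => projT2 (cid (projT2 (cid (arX X)))))).
Qed.

End Duality.

(** * The opposite exact category *)

Section Opposite.
Variables (k : comPzRingType) (E : lmodType k) (C : exactCat k).
Local Notation D := (op_exactCat C).
Local Notation ExtD := (@Ext k D).
Implicit Types X Y Z K : C.

Definition unop_conf X Y (c : @conflation k D X Y) : @conflation k C Y X :=
  @Conflation k C Y X (c_mid c) (c_def c) (c_inf c) (c_conf c).
Definition op_conf X Y (c : @conflation k C Y X) : @conflation k D X Y :=
  @Conflation k D X Y (c_mid c) (c_def c) (c_inf c) (c_conf c).

Definition unop_ext X Y (x : ExtD X Y) : @Ext k C Y X := cl (unop_conf (rep x)).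

Lemma unop_mor X Y X' Y' (f : hom Y' Y) (g : hom X' X) (x : ExtD X Y) (x' : ExtD X' Y') :
  @mor k D Y X Y' X' f g x x' -> mor g f (unop_ext x') (unop_ext x).
Proof. by move=> [h [hi hd]]; apply: cmor_cl; exists h. Qed.

Lemma unop_push X Y Y' (f : hom Y' Y) (x : ExtD X Y) :
  unop_ext (@push k D Y Y' X f x) = pull f (unop_ext x).
Proof.
by rewrite -[LHS]push1; apply/mor_eq/unop_mor/(@mor_push k D).
Qed.

Lemma unop_pull X X' Y (g : hom X X') (x : ExtD X Y) :
  unop_ext (@pull k D Y X X' g x) = push g (unop_ext x).
Proof.
by rewrite -[LHS]pull1; apply/esym/mor_eq/unop_mor/(@mor_pull k D).
Qed.

Lemma unop_surj X Y (z : @Ext k C Y X) : exists x : ExtD X Y, unop_ext x = z.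
Proof.
exists (cl (op_conf (rep z))); rewrite -[RHS]repK.
have /clP[h [_ hi hd]] := esym (repK (cl (op_conf (rep z)))).
exact: (@cl_eq k C _ _ (unop_conf _) (rep z) h).
Qed.

Lemma unop_inj X Y : injective (@unop_ext X Y).
Proof.
move=> x y /esym/clP[h [_ hi hd]].
by apply: mor1_eq; exists h; rewrite comp1m compm1.
Qed.

(** The Baer sums of the two categories are not compared directly. Both summands are written as
    pullbacks in [D] of a single [w] along the projections of a biproduct; their sum is then the
    pullback along the sum of the projections, and additivity of push in that morphism finishes. *)
Lemma unop_linear X Y : linear (@unop_ext X Y).
Proof.
have scale a (x : ExtD X Y) : unop_ext (a *: x) = a *: unop_ext x.
  by rewrite -[RHS]pull_scalar -unop_push.
suff add (x y : ExtD X Y) : unop_ext (x + y) = unop_ext x + unop_ext y.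
  by move=> a x y; rewrite add scale.
pose B := bp X X.
have [w wE] := unop_surj (push (bp_inl B) (unop_ext x) + push (bp_inr B) (unop_ext y)).
have wl : @pull k D _ _ _ (bp_prl B) w = x.
  apply: unop_inj; rewrite unop_pull wE linearD /= !push_push bp_ll bp_lr.
  by rewrite push1 push0; apply: addr0.
have wr : @pull k D _ _ _ (bp_prr B) w = y.
  apply: unop_inj; rewrite unop_pull wE linearD /= !push_push bp_rl bp_rr.
  by rewrite push1 push0; apply: add0r.
by rewrite -{1}wl -{1}wr -pullDl unop_pull pushDl -!unop_pull wl wr.
Qed.

Lemma unop_eq0 X Y (x : ExtD X Y) : unop_ext x = 0 <-> x = 0.
Proof.
have e : @unop_ext X Y 0 = 0 by apply: (linear0 (mklin (@unop_linear X Y))).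
by split=> [|-> //]; rewrite -e => /unop_inj.
Qed.

(** Passing to the opposite category interchanges push and pull, hence the two halves of the
    definition. *)
Lemma ar_op X K (eta : {linear @Ext k C X K -> E}) (eta' : {linear ExtD K X -> E}) :
  (forall x, eta' x = eta (unop_ext x)) ->
  AR_pair eta <-> @AR_pair k E D K X eta'.
Proof.
move=> eE; split=> -[pn pt ln lt]; split.
- move=> Y z z0; have [|g gz] := ln Y (unop_ext z); first by move=> /unop_eq0.
  by exists g; rewrite eE unop_push.
- move=> Y u uz Z z; apply/unop_eq0; rewrite unop_push; apply: lt => w.
  by have [x <-] := unop_surj w; rewrite -unop_push -eE.
- move=> Y z z0; have [|g gz] := pn Y (unop_ext z); first by move=> /unop_eq0.
  by exists g; rewrite eE unop_pull.
- move=> Y u uz Z z; apply/unop_eq0; rewrite unop_pull; apply: pt => w.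
  by have [x <-] := unop_surj w; rewrite -unop_pull -eE.
- move=> Y z; have [x <-] := unop_surj z => x0.
  have [|g gz] := ln Y x; first by move=> e; apply/x0/unop_eq0.
  by exists g; rewrite -unop_pull -eE.
- move=> Y u uz Z z; have [x <-] := unop_surj z; rewrite -unop_pull.
  by apply/unop_eq0/lt => w; rewrite eE unop_pull.
- move=> Y z; have [x <-] := unop_surj z => x0.
  have [|g gz] := pn Y x; first by move=> e; apply/x0/unop_eq0.
  by exists g; rewrite -unop_push -eE.
- move=> Y u uz Z z; have [x <-] := unop_surj z; rewrite -unop_push.
  by apply/unop_eq0/pt => w; rewrite eE unop_push.
Qed.

Lemma ar_op_ex X K : (exists eta : {linear @Ext k C X K -> E}, AR_pair eta) <->
  (exists eta' : {linear ExtD K X -> E}, AR_pair eta').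
Proof.
split=> [[eta ar]|[eta' ar]].
  exists (eta \o mklin (@unop_linear K X) : {linear _ -> _}).
  have [+ _] := ar_op (eta := eta)
    (eta' := eta \o mklin (@unop_linear K X) : {linear _ -> _}) (fun=> erefl).
  by apply.
have /choice[op opK] := @unop_surj K X.
have opL : linear op.
  by move=> a z z'; apply: unop_inj; rewrite unop_linear !opK.
exists (eta' \o mklin opL : {linear _ -> _}).
have [|_] := ar_op (eta := eta' \o mklin opL : {linear _ -> _}) (eta' := eta');
  last by apply.
by move=> x /=; congr (eta' _); apply: unop_inj; rewrite opK.
Qed.

Lemma has_AR_pairs_op : has_AR_pairs E C <-> has_AR_pairs E D.
Proof.
split=> -[arX arK]; split=> [X|X].
- by have [Y /ar_op_ex] := arK X; exists Y.
- by have [Y /ar_op_ex] := arX X; exists Y.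
- by have [Y /ar_op_ex] := arK X; exists Y.
- by have [Y /ar_op_ex] := arX X; exists Y.
Qed.

Lemma hom_finite_op : hom_finite C -> hom_finite D.
Proof. by move=> fin X Y; apply: fin. Qed.

Lemma is_iso_op X Y (f : hom X Y) : @is_iso k D Y X f <-> is_iso f.
Proof. by split=> -[g [gf fg]]; exists g. Qed.

Lemma krull_schmidt_op : krull_schmidt C -> krull_schmidt D.
Proof.
move=> KS X; have [n [F [[inj [prj [pi1 pi0 s]]] loc]]] := KS X.
exists n, F; split.
  by exists prj, inj; split=> // i j ij; apply: pi0 => e; apply: ij.
move=> i; have [id0 add] := loc i; split=> // f g nf ng.
by move=> /is_iso_op; apply: add => /is_iso_op.
Qed.

End Opposite.

Theorem theorem7p2 (k : comPzRingType) (kdual : lmodType k)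
    (C : exactCat k) :
  artinian k -> minimal_injective_cogenerator kdual ->
  hom_finite C -> krull_schmidt C ->
  (AR_duality C kdual <-> right_stably_determined_deflations C) /\
  (right_stably_determined_deflations C <->
     left_stably_determined_inflations C).
Proof.
move=> k_art E_min C_fin C_KS.
have det (C' : exactCat k) : hom_finite C' -> krull_schmidt C' ->
    right_stably_determined_deflations C' <-> has_AR_pairs kdual C'.
  by move=> fin KS; split; [apply: determined_AR_pairs | apply: AR_pairs_determined].
split; rewrite det //.
  by split; [apply: AR_duality_pairs | apply: AR_pairs_duality].
by rewrite has_AR_pairs_op -det //; [apply: hom_finite_op | apply: krull_schmidt_op].
Qed.
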